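(* Let $W$ be a positive random variable and, for $n\ge 1$, let $W_1,\dots,W_n$ be independent copies of $W$. Let $G_n$ be the generalized random graph on the vertex set $\{1,\dots,n\}$ with vertex weights $W_1,\dots,W_n$: conditionally on $(W_1,\dots,W_n)$, each pair $\{i,j\}$ with $i\neq j$ is joined by an edge independently of all other pairs, with probability $$p_{ij}=\frac{W_iW_j}{L_n+W_iW_j},\qquad L_n=\sum_{i=1}^n W_i,$$ and there are no self-loops. Fix an integer $k\ge 3$ and let $S_n(k)$ be the number of cycles of length $k$ in $G_n$. Let $Z_k$ be a Poisson random variable with parameter $\lambda(k)=\frac{1}{2k}\left(\frac{\mathbb{E}W^2}{\mathbb{E}W}\right)^k$. If $$\mathbb{P}(W>x)=o(x^{-2k-1})\quad\text{as }x\to+\infty,$$ then $$\|\mathcal{L}(S_n(k))-\mathcal{L}(Z_k)\| = O(n^{-1/2})\quad\text{as } n\to\infty.$$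
   Context: A cycle of length $k$ is a set of $k$ distinct vertices $v_0,\dots,v_{k-1}$ with edges $v_0v_1, v_1v_2,\dots,v_{k-2}v_{k-1},v_{k-1}v_0$ all present; cycles are counted without regard to starting point or orientation, so there are $(n)_k/(2k)$ potential cycles of length $k$, where $(n)_k=n(n-1)\cdots(n-k+1)$. For non-negative integer-valued random variables $Y,Z$, $\|\mathcal{L}(Y)-\mathcal{L}(Z)\|=\sup_{\|h\|=1}|\mathbb{E}h(Y)-\mathbb{E}h(Z)|$, where the supremum is over real functions $h$ on $\{0,1,2,\dots\}$ with $\|h\|=\sup_{m\ge0}|h(m)|=1$. *)

(* Defs.v *)
From HB Require Import structures.
From mathcomp Require Import all_boot all_order all_algebra.
From mathcomp Require Import all_classical all_reals all_analysis.
Set Implicit Arguments.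
Unset Strict Implicit.
Unset Printing Implicit Defensive.
Import Order.TTheory GRing.Theory Num.Theory.

Local Open Scope classical_set_scope.
Local Open Scope ring_scope.

Section generalized_random_graph.
Context {R : realType}.

Definition pairs (n : nat) : {set {set 'I_n}} := ([set e : {set 'I_n} | #|e| == 2%N])%SET.

Definition edge_prob (n : nat) (w : 'I_n -> R) (e : {set 'I_n}) : R :=
  let we := \prod_(v in e) w v in we / (\sum_(i < n) w i + we).

Definition graph_prob (n : nat) (w : 'I_n -> R) (g : {set {set 'I_n}}) : R :=
  \prod_(e in pairs n) (if e \in g then edge_prob w e else 1 - edge_prob w e).

Definition cycle_edges (n k : nat) (v : 'I_k -> 'I_n) : {set {set 'I_n}} :=
  ([set ([set v i; v (ordS i)])%SET | i : 'I_k])%SET.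

(* Number of cycles of length k in g: a cycle is determined by its edge set
   (counted without regard to starting point or orientation); it is the edge
   set of v_0 ... v_{k-1} v_0 for k distinct vertices v_i. *)
Definition num_cycles (n k : nat) (g : {set {set 'I_n}}) : nat :=
  #|[set C : {set {set 'I_n}} | (C \subset g) &&
      [exists v : {ffun 'I_k -> 'I_n}, injectiveb v && (C == cycle_edges v)]]|.

Definition grg_cond_Eh (n k : nat) (w : 'I_n -> R) (h : nat -> R) : R :=
  \sum_(g in powerset (pairs n)) h (num_cycles k g) * graph_prob w g.

(* W_0, ..., W_{n-1} are independent copies of W (mutual independence:
   product rule for every family of Borel sets; subfamilies are obtained by
   taking B i = setT). *)
Definition iid_copies d (T : measurableType d) (P : probability T R)
    (W : {RV P >-> R}) (n : nat) (X : 'I_n -> {RV P >-> R}) : Prop :=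
  (forall (i : 'I_n) (B : set R), measurable B ->
     P (X i @^-1` B) = P (W @^-1` B)) /\
  (forall B : 'I_n -> set R, (forall i, measurable (B i)) ->
     P (\bigcap_(i in [set: 'I_n]) (X i @^-1` B i)) =
     (\prod_(i < n) P (X i @^-1` B i))%E).

Definition sup_norm (h : nat -> R) : \bar R :=
  ereal_sup (range (fun m => (`|h m|)%:E)).

(* || L(Y) - L(Z) || = sup_{||h|| = 1} | E h(Y) - E h(Z) |, where EhY h and
   EhZ h are E h(Y) and E h(Z). *)
Definition tv_dist (EhY EhZ : (nat -> R) -> \bar R) : \bar R :=
  ereal_sup [set (`| EhY h - EhZ h |)%E | h in [set h | sup_norm h = 1%E]].

Definition poisson_Eh (lam : R) (h : nat -> R) : R :=
  \big[+%R/0%R]_(0 <= m <oo) (h m * poisson_pmf lam m).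

End generalized_random_graph.

(* Main.v *)
(** Conditionally on the weights, the Stein-Chen method with the solution [f]
of the Stein equation for the limiting parameter [lam] reduces the claim to
bounds on [|lam - lam_w|], where [lam_w] is the conditional mean of the number
of cycles, and on the sum of [P(C, C' in G)] over pairs of cycles sharing an
edge. A union of two distinct cycles sharing an edge has more edges than
vertices, so with [L = sum w] and [Q = sum w^2 (1 + w)^2 / L] this sum is at
most [(k + Q)^k Q^k / L]; likewise [lam_w] is [(sum w^2 / L)^k / 2k] up to
[O(1 / L)] for bounded [Q]. The tail assumption gives a finite sixth moment:
Chebyshev's inequality applied to the averages of [W], [W^2] and of
[W^2 (1 + W)^2] truncated at [W <= n^(1/4)], together with
[n P(W > n^(1/4)) = O(n^(-1/2))], then shows that [Q] is bounded and [L] is of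
order [n] outside an event of probability [O(n^(-1/2))], and that the empirical
means entering [lam_w] fluctuate on the scale [n^(-1/2)]. *)

Require Import Defs.
From HB Require Import structures.
From mathcomp Require Import all_boot all_order all_algebra reals.
From mathcomp Require classical_sets.
From mathcomp Require Import ring lra zify.
Import Order.TTheory GRing.Theory Num.Theory.
Local Open Scope ring_scope.

(** * Random subsets with independent elements *)

(** The Stein equation is taken at the limiting parameter so that [f], and its bound [2 * expR lam],
    are deterministic; the random mean [lam_w] then enters only through its distance to [lam]. The
    factor [(1 + w)^2] in [Q] pays for shared vertices: a vertex on two cycles can have degree four
    in their union, twice what a single cycle charges. This makes the summand of [Q] of degree four,
    so Chebyshev's inequality would need an eighth moment, while for [k = 3] the tail only ensures
    moments of order below seven. Truncating at [tau] bounds the squared summand by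
    [4 tau^2 (1 + W)^6], at a cost of order [tau^2 / n]; some weight exceeding [tau] costs
    [n tau^-6]. Both are [n^(-1/2)] exactly when [tau = n^(1/4)]. No exceptional event is formed. A
    single inequality, valid for all positive weights, bounds the conditional error by a sum of
    nonnegative terms, one of which is bounded below by a positive constant whenever the weights are
    bad; the trivial bound 2 suffices there. Only integrals of nonnegative functions then have to be
    estimated. *)

Section random_subset.
Context {R : realFieldType} {T : finType}.
Variable p : T -> R.
Hypothesis p01 : forall e, 0 <= p e <= 1.
Implicit Types (g C D : {set T}) (F : {set T} -> R).

Definition subset_prob g : R := \prod_e (if e \in g then p e else 1 - p e).
Definition subset_Exp F : R := \sum_g F g * subset_prob g.
Definition incl_prob D : R := \prod_(e in D) p e.

Lemma subset_prob_ge0 g : 0 <= subset_prob g.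
Proof.
apply: prodr_ge0 => e _; case: ifP => _; last rewrite subr_ge0.
  by case/andP: (p01 e).
by case/andP: (p01 e).
Qed.

Lemma incl_prob_ge0 D : 0 <= incl_prob D.
Proof. by apply: prodr_ge0 => e _; case/andP: (p01 e). Qed.

Lemma subset_Exp_cst c : subset_Exp (fun=> c) = c.
Proof.
rewrite /subset_Exp -big_distrr /= -[RHS]mulr1; congr (_ * _).
rewrite -(@bigA_distr R 0 1 _ _ T p (fun e => 1 - p e)).
by apply: big1 => e _; rewrite /= subrKC.
Qed.

Lemma subset_ExpD F G :
  subset_Exp (fun g => F g + G g) = subset_Exp F + subset_Exp G.
Proof. by rewrite -big_split; apply: eq_bigr => g _; rewrite mulrDl. Qed.

Lemma subset_ExpZ c F : subset_Exp (fun g => c * F g) = c * subset_Exp F.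
Proof. by rewrite /subset_Exp mulr_sumr; apply: eq_bigr => g _; rewrite mulrA. Qed.

Lemma subset_Exp_sum (I : finType) (P : pred I) (F : I -> {set T} -> R) :
  subset_Exp (fun g => \sum_(i | P i) F i g) = \sum_(i | P i) subset_Exp (F i).
Proof. by rewrite exchange_big; apply: eq_bigr => g _; rewrite mulr_suml. Qed.

Lemma ler_subset_Exp F G : (forall g, F g <= G g) -> subset_Exp F <= subset_Exp G.
Proof. by move=> FG; apply: ler_sum => g _; rewrite ler_wpM2r ?subset_prob_ge0. Qed.

Lemma ler_norm_subset_Exp F : `|subset_Exp F| <= subset_Exp (fun g => `|F g|).
Proof.
apply: le_trans (ler_norm_sum _ _ _) _; apply: ler_sum => g _.
by rewrite normrM (ger0_norm (subset_prob_ge0 g)).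
Qed.

(** Sets containing [e] are paired with the same sets without [e]: the two probabilities share every
    other factor, and [p e + (1 - p e) = 1]. *)
Lemma subset_Exp_mem e F :
  subset_Exp (fun g => (e \in g)%:R * F g) = p e * subset_Exp (fun g => F (e |: g)).
Proof.
pose r g := \prod_(x | x != e) (if x \in g then p x else 1 - p x).
have rU g : r (e |: g) = r g.
  by apply: eq_bigr => x xe; rewrite !inE (negbTE xe).
have rD g : r (g :\ e) = r g.
  by apply: eq_bigr => x xe; rewrite !inE xe.
have wE g : subset_prob g = (if e \in g then p e else 1 - p e) * r g.
  by rewrite /subset_prob (bigD1 e).
have split_mem (G : {set T} -> R) :
    \sum_g G g = \sum_(g : {set T} | e \in g) (G g + G (g :\ e)).
  rewrite (bigID (fun g : {set T} => e \in g)) /= big_split; congr (_ + _).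
  rewrite (reindex_onto (fun g => g :\ e) (fun g => e |: g)) /=; last first.
    by move=> g eg; rewrite setU1K.
  apply: eq_bigl => g; rewrite !inE eqxx /=.
  apply/eqP/idP => [<-|eg]; first by rewrite setU11.
  by rewrite setD1K.
rewrite /subset_Exp !split_mem mulr_sumr; apply: eq_bigr => g eg /=.
rewrite !wE !rD !inE eqxx eg /= setD1K // (setUidPr _) ?sub1set //.
by rewrite mul1r !mul0r addr0; ring.
Qed.

(** The conditional law of [g] given [C \subset g] is the law of [g :|: C]. The product form avoids
    dividing by [incl_prob C], which may be 0. Elements of [C] are removed one at a time. *)
Lemma subset_Exp_incl C F :
  subset_Exp (fun g => (C \subset g)%:R * F g) =
  incl_prob C * subset_Exp (fun g => F (g :|: C)).
Proof.
have [m] := ubnP #|C|; elim: m => // m IH in C F *.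
case: (set_0Vmem C) => [->|[e eC]] leCm.
  rewrite /incl_prob big_set0 mul1r /subset_Exp; apply: eq_bigr => g _.
  by rewrite sub0set mul1r setU0.
have CE : C = e |: (C :\ e) by rewrite setD1K.
have -> : subset_Exp (fun g => (C \subset g)%:R * F g) =
    subset_Exp (fun g => (e \in g)%:R * ((C :\ e \subset g)%:R * F g)).
  apply: eq_bigr => g _; rewrite mulrA -natrM mulnb -sub1set -subUset.
  by rewrite setD1K.
rewrite subset_Exp_mem.
have -> : subset_Exp (fun g => (C :\ e \subset e |: g)%:R * F (e |: g)) =
    subset_Exp (fun g => (C :\ e \subset g)%:R * F (e |: g)).
  apply: eq_bigr => g _; congr (_%:R * _ * _); congr nat_of_bool.
  rewrite -subDset (_ : C :\ e :\ e = C :\ e) //.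
  by apply/setP => x; rewrite !inE; case: eqP.
rewrite IH; last by move: leCm; rewrite (cardsD1 e C) eC.
rewrite mulrA /incl_prob [in RHS](bigD1 e) //=; congr (_ * _ * _).
  by apply: eq_bigl => x; rewrite !inE andbC.
by apply: eq_bigr => g _; rewrite setUCA [e |: _]setD1K.
Qed.

Lemma subset_Exp_ind C : subset_Exp (fun g => (C \subset g)%:R) = incl_prob C.
Proof.
have := subset_Exp_incl C (fun=> 1); rewrite subset_Exp_cst mulr1 => <-.
by apply: eq_bigr => g _; rewrite mulr1.
Qed.

Variable CC : {set {set T}}.

Definition num_incl g : nat := #|[set C in CC | C \subset g]|.

(** Adding [C] can complete another [C'] only if [C'] meets [C] and the rest of [C'] is already
    present; a [C'] disjoint from [C] is unaffected. *)
Lemma num_inclU C g : C \in CC -> ~~ (C \subset g) ->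
  (forall C', C' \in CC -> C' != C -> C :&: C' != set0 -> ~~ (C' :\: C \subset g)) ->
  num_incl (g :|: C) = (num_incl g).+1.
Proof.
move=> CCC Cg H; rewrite /num_incl.
rewrite (_ : [set C' in CC | C' \subset g :|: C] = C |: [set C' in CC | C' \subset g]).
  by rewrite cardsU1 !inE CCC (negbTE Cg).
apply/setP => C'; rewrite !inE; case: (eqVneq C' C) => [->|C'C] /=.
  by rewrite CCC subsetUr.
case: (boolP (C' \in CC)) => //= C'CC.
apply/idP/idP => [|C'g]; last exact: subset_trans C'g (subsetUl _ _).
rewrite setUC -subDset => sub.
have [C0|C0] := eqVneq (C :&: C') set0; last by move: (H _ C'CC C'C C0); rewrite sub.
apply: subset_trans sub; rewrite subsetD subxx /=.
by rewrite -setI_eq0 setIC C0.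
Qed.

(* Conditioning on [C \subset g] replaces [g] by [g :|: C], so that the local
   dependence enters only through the sets meeting [C]. *)
Lemma stein_subset_bound (lam B : R) (f : nat -> R) : (forall m, `|f m| <= B) ->
  `|subset_Exp (fun g => lam * f (num_incl g).+1 - (num_incl g)%:R * f (num_incl g))|
  <= B * `|lam - \sum_(C in CC) incl_prob C| +
     2 * B * \sum_(C in CC) (incl_prob C * (incl_prob C +
       \sum_(C' in CC | (C' != C) && (C :&: C' != set0)) incl_prob (C' :\: C))).
Proof.
move=> fB; set Lam := \sum_(C in CC) incl_prob C.
have B0 : 0 <= B := le_trans (normr_ge0 _) (fB 0%N).
pose Ef := subset_Exp (fun g => f (num_incl g).+1).
(* Writing the count as a sum of indicators and conditioning on each gives [E[N f(N)]] as the sum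
   over [C] of [incl_prob C] times the mean of [f] at the count of [g :|: C]. Each term is compared
   with [E[f(N + 1)]], which uses up [Lam] out of [lam]. *)
have -> : subset_Exp (fun g => lam * f (num_incl g).+1 - (num_incl g)%:R * f (num_incl g))
   = (lam - Lam) * Ef + \sum_(C in CC) incl_prob C *
     subset_Exp (fun g => f (num_incl g).+1 + (-1) * f (num_incl (g :|: C))).
  have -> : \sum_(C in CC) incl_prob C *
     subset_Exp (fun g => f (num_incl g).+1 + (-1) * f (num_incl (g :|: C))) =
     Lam * Ef - subset_Exp (fun g => (num_incl g)%:R * f (num_incl g)).
    rewrite mulr_suml -[X in _ = _ - X](_ : \sum_(C in CC)
        subset_Exp (fun g => (C \subset g)%:R * f (num_incl g)) = _).
      rewrite -sumrB; apply: eq_bigr => C _.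
      rewrite (subset_Exp_incl C (fun g => f (num_incl g))).
      by rewrite subset_ExpD subset_ExpZ; rewrite /Ef; ring.
    rewrite -subset_Exp_sum; apply: eq_bigr => g _; congr (_ * _).
    rewrite -mulr_suml; congr (_ * _).
    rewrite -natr_sum; congr (_%:R); rewrite /num_incl -sum1_card.
    rewrite [RHS](eq_bigl (fun C => (C \in CC) && (C \subset g))); last first.
      by move=> C; rewrite inE.
    by rewrite [RHS]big_mkcondr; apply: eq_bigr => C _; case: (C \subset g).
  rewrite -[X in X = _](_ : lam * Ef +
     (-1) * subset_Exp (fun g => (num_incl g)%:R * f (num_incl g)) = _).
    by ring.
  rewrite -!subset_ExpZ -subset_ExpD; apply: eq_bigr => g _; ring.
apply: le_trans (ler_normD _ _) _; apply: lerD.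
  rewrite normrM mulrC ler_wpM2r //.
  apply: le_trans (ler_norm_subset_Exp _) _.
  by rewrite -[X in _ <= X]subset_Exp_cst; apply: ler_subset_Exp.
apply: le_trans (ler_norm_sum _ _ _) _.
rewrite mulr_sumr; apply: ler_sum => C CCC.
rewrite normrM ger0_norm ?incl_prob_ge0 // mulrCA ler_wpM2l ?incl_prob_ge0 //.
apply: le_trans (ler_norm_subset_Exp _) _.
rewrite -subset_Exp_ind.
under [in X in _ <= _ * (_ + X)]eq_bigr do rewrite -subset_Exp_ind.
rewrite -subset_Exp_sum -subset_ExpD -subset_ExpZ; apply: ler_subset_Exp => g.
set s := \sum_(_ in _ | _) _.
have s0 : 0 <= s by apply: sumr_ge0.
(* If one of the indicators is 1, the trivial bound [2 * B] is enough. Otherwise [num_inclU] makes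
   the two arguments of [f] equal and the difference vanishes. *)
have [ge1|lt1] := lerP 1 ((C \subset g)%:R + s).
  apply: (@le_trans _ _ (2 * B * 1)); last by rewrite ler_wpM2l // mulr_ge0.
  apply: le_trans (ler_normD _ _) _; rewrite normrM normrN1 mul1r.
  by have := fB (num_incl g).+1; have := fB (num_incl (g :|: C)); lra.
rewrite num_inclU //; first by rewrite mulN1r subrr normr0 !mulr_ge0 ?addr_ge0.
  by apply: contraTN lt1 => ->; rewrite -leNgt lerDl.
move=> C' C'CC C'C CC'; apply: contraTN lt1 => sub; rewrite -leNgt.
rewrite /s (bigD1 C') /=; last by rewrite C'CC C'C.
rewrite sub addrCA lerDl addr_ge0 //; apply: sumr_ge0 => //.
Qed.

End random_subset.

(** * Labelings of cycles *)

Section cycle_labelings.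
Variables (m n : nat).
Local Notation I := 'I_m.+3.
Implicit Types (u v : {ffun I -> 'I_n}) (i j : I).

(** With [k = m + 3] the positions form the ring of integers modulo [k]: the cyclic successor is
    addition of 1, and rotations and reflections are affine maps. *)
Lemma ordSE i : ordS i = i + 1.
Proof. by apply: val_inj; rewrite /= (modn_small (_ : 1 < m.+3)%N) ?addn1. Qed.

(** This is where [k >= 3] enters: distinct positions carry distinct edges, a reflection is never a
    rotation, and two steps along a cycle do not lead back. *)
Let two_neq0 : 1 + 1 != 0 :> I.
Proof. by []. Qed.

Definition cycle_edge v i : {set 'I_n} := [set v i; v (i + 1)].

Lemma cycle_edgesE v : cycle_edges v = [set cycle_edge v i | i : I].
Proof. by apply: eq_imset => i; rewrite ordSE. Qed.

Lemma cycle_edge_inj v : injective v -> injective (cycle_edge v).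
Proof.
move=> vI i j eij.
have /set2P[/vI //|/vI eq1] : v i \in cycle_edge v j by rewrite -eij set21.
have /set2P[/vI|/vI/addIr //] : v (i + 1) \in cycle_edge v j by rewrite -eij set22.
rewrite eq1 -addrA => /eqP; rewrite -subr_eq0 addrAC subrr add0r => /eqP e.
by move: two_neq0; rewrite e eqxx.
Qed.

Lemma cycle_edges_pairs v : injective v -> cycle_edges v \subset pairs n.
Proof.
move=> vI; rewrite cycle_edgesE; apply/subsetP => e /imsetP[i _ ->].
rewrite inE cards2 (inj_eq vI) -subr_eq0 opprD addrA subrr add0r oppr_eq0.
by rewrite oner_eq0.
Qed.

Lemma card_cycle_edges v : injective v -> #|cycle_edges v| = m.+3.
Proof.
by move=> /cycle_edge_inj vI; rewrite cycle_edgesE card_imset ?card_ord.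
Qed.

Definition cycles : {set {set {set 'I_n}}} :=
  [set C | [exists v : {ffun I -> 'I_n}, injectiveb v && (C == cycle_edges v)]].

Lemma num_cyclesE g : num_cycles m.+3 g = num_incl cycles g.
Proof.
apply: eq_card => C; apply/idP/idP; rewrite classical_sets.in_setE /classical_sets.mkset !inE.
  by rewrite andbC.
by rewrite andbC.
Qed.

(* Rotations ([b = false]) and reflections ([b = true]) of a labeling. *)
Definition relabel v (ab : I * bool) : {ffun I -> 'I_n} :=
  [ffun i => v (ab.1 + (-1) ^+ ab.2 * i)].

Lemma relabel_injective v ab : injective v -> injective (relabel v ab).
Proof.
case: ab => a b vI i j; rewrite !ffunE => /vI /addrI.
by case: b; rewrite ?expr1 ?expr0 ?mulN1r ?mul1r // => /oppr_inj.
Qed.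

Lemma relabel_edges v ab : injective v -> cycle_edges (relabel v ab) = cycle_edges v.
Proof.
move=> vI; apply/eqP.
rewrite eqEcard !card_cycle_edges //; last exact: relabel_injective.
rewrite leqnn andbT !cycle_edgesE; apply/subsetP => e /imsetP[i _ ->].
rewrite /cycle_edge !ffunE; case: ab => a [] /=.
  rewrite expr1 !mulN1r; apply/imsetP; exists (a - (i + 1)) => //.
  by rewrite opprD !addrA subrK setUC.
by rewrite expr0 !mul1r; apply/imsetP; exists (a + i); rewrite // addrA.
Qed.

Lemma relabel_inj v : injective v -> injective (relabel v).
Proof.
move=> vI [a b] [a' b'] /ffunP E.
have := E 0; rewrite !ffunE /= !mulr0 !addr0 => /vI ea; subst a'.
have := E 1; rewrite !ffunE /= !mulr1 => /vI /addrI eb.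
congr (_, _); case: b b' eb {E} => [] [] // /eqP; rewrite ?expr0 ?expr1.
  by rewrite eq_sym -subr_eq0 opprK (negbTE two_neq0).
by rewrite -subr_eq0 opprK (negbTE two_neq0).
Qed.

Lemma cycle_neighbour v x i : injective v -> x != v i ->
  [set v i; x] \in cycle_edges v -> x = v (i + 1) \/ x = v (i - 1).
Proof.
move=> vI xi; rewrite cycle_edgesE => /imsetP[j _ E].
have := set21 (v i) x; rewrite E => /set2P[/vI|/vI] ij; subst.
  have := set22 (v j) x; rewrite E => /set2P[xj|->]; last by left.
  by rewrite xj eqxx in xi.
have := set22 (v (j + 1)) x; rewrite E => /set2P[->|xj].
  by right; rewrite addrK.
by rewrite xj eqxx in xi.
Qed.

(** A labeling is determined by its start and its first step: [u 0 = v a] fixes the rotation, [u 1]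
    fixes the direction, and then an injective walk along the cycle has no choice left. *)
Lemma same_edges_relabel u v : injective u -> injective v ->
  cycle_edges u = cycle_edges v -> exists ab, u = relabel v ab.
Proof.
move=> uI vI E.
have edge i : [set u i; u (i + 1)] \in cycle_edges v.
  by rewrite -E cycle_edgesE; apply: imset_f.
have next i j : u i = v j -> u (i + 1) = v (j + 1) \/ u (i + 1) = v (j - 1).
  move=> uv; apply: cycle_neighbour => //; last by rewrite -uv.
  rewrite -uv (inj_eq uI) -subr_eq0 addrAC subrr add0r; exact: oner_neq0.
have [a ua] : exists a, u 0 = v a.
  have := edge 0; rewrite cycle_edgesE => /imsetP[j _ /setP /(_ (u 0))].
  by rewrite set21 => /esym/set2P[->|->]; [exists j | exists (j + 1)].
have [b ub] : exists b : bool, u 1 = v (a + (-1) ^+ b).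
  have := next 0 a ua; rewrite add0r => -[->|->]; first by exists false.
  by exists true.
exists (a, b); set s : I := (-1) ^+ b in ub.
have s2 : s + s != 0.
  by rewrite /s; case: (b); rewrite ?expr0 ?expr1 // -opprD oppr_eq0.
(* Two consecutive positions are carried in the induction: of the two neighbours of the current
   vertex, the previous position excludes the one behind. *)
have H (t : nat) : u t%:R = v (a + s * t%:R) /\ u t.+1%:R = v (a + s * t.+1%:R).
  elim: t => [|t [IH1 IH2]]; first by rewrite mulr0 mulr1 addr0.
  split=> //; have := next _ _ IH2; rewrite natr1.
  have neq : u t.+2%:R != u t%:R.
    rewrite (inj_eq uI) -subr_eq0 -[t.+2]addn2 natrD addrAC subrr add0r.
    exact: two_neq0.
  have ss : s = 1 \/ s = -1 by rewrite /s; case: (b); rewrite ?expr0 ?expr1; auto.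
  case=> E'; rewrite E' IH1 (inj_eq vI) in neq; rewrite E'.
    case: ss neq => -> neq; first by congr (v _); ring.
    by case/negP: neq; apply/eqP; ring.
  case: ss neq => -> neq; last by congr (v _); ring.
  by case/negP: neq; apply/eqP; ring.
apply/ffunP => i; rewrite ffunE /= -/s.
by have [] := H i; rewrite natr_Zp.
Qed.

(** The labelings of one cycle form a free orbit of the dihedral group of order [2k]: free by
    [relabel_inj], a single orbit by [same_edges_relabel]. This is the origin of the factor
    [1 / (2k)] in the Poisson parameter. *)
Lemma card_labelings v : injective v ->
  #|[set u : {ffun I -> 'I_n} | injectiveb u && (cycle_edges u == cycle_edges v)]|
  = (2 * m.+3)%N.
Proof.
move=> vI; rewrite -[RHS]mulnC -card_bool -[X in (X * _)%N]card_ord -card_prod.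
rewrite -(card_imset _ (relabel_inj _ vI)); apply: eq_card => u; rewrite inE.
apply/andP/imsetP => [[/injectiveP uI /eqP E]|[ab _ ->]].
  by have [ab ->] := same_edges_relabel _ _ uI vI E; exists ab.
split; first by apply/injectiveP/relabel_injective.
by rewrite relabel_edges.
Qed.

Lemma sum_labelings (R : numDomainType) (F : {set {set 'I_n}} -> R) :
  \sum_(v : {ffun I -> 'I_n} | injectiveb v) F (cycle_edges v) =
  (2 * m.+3)%:R * \sum_(C in cycles) F C.
Proof.
rewrite (partition_big (fun v : {ffun I -> 'I_n} => cycle_edges v)
  (mem cycles)) /=; last first.
  by move=> v vI; rewrite inE; apply/existsP; exists v; rewrite vI eqxx.
rewrite mulr_sumr; apply: eq_bigr => C.
rewrite inE => /existsP[v /andP[/injectiveP vI /eqP ->]].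
rewrite (eq_bigr (fun=> F (cycle_edges v))) => [|u /andP[_ /eqP -> //]].
rewrite sumr_const -[LHS]mulr_natl -(card_labelings _ vI); congr (_%:R * _).
by apply: eq_card => u; rewrite inE.
Qed.

Lemma sum_cycles_le (R : numDomainType) (F : {set {set 'I_n}} -> R) :
  (forall C, 0 <= F C) ->
  \sum_(C in cycles) F C <=
  \sum_(v : {ffun I -> 'I_n} | injectiveb v) F (cycle_edges v).
Proof.
by move=> F0; rewrite sum_labelings ler_peMl ?ler1n // sumr_ge0.
Qed.

End cycle_labelings.

(** * Bounds for fixed weights *)

Section products.
Context {R : realFieldType}.

(** A sum over all labelings factors over the positions; for this reason the estimates below pass
    from injective labelings to arbitrary ones. *)
Lemma sum_prod_dffun (I J : finType) (F : I -> J -> R) :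
  \sum_(v : {ffun I -> J}) \prod_i F i (v i) = \prod_i \sum_y F i y.
Proof. by rewrite (bigA_distr_bigA (F : I -> J -> R)). Qed.

Lemma sum_prod_ffun (I J : finType) (F : J -> R) :
  \sum_(v : {ffun I -> J}) \prod_i F (v i) = (\sum_y F y) ^+ #|I|.
Proof. by rewrite (sum_prod_dffun _ _ (fun=> F)) prodr_const. Qed.

Lemma prodr_ge1 (I : finType) (P : pred I) (F : I -> R) :
  (forall i, P i -> 1 <= F i) -> 1 <= \prod_(i | P i) F i.
Proof.
move=> F1; elim/big_rec: _ => // i x Pi x1.
by apply: mulr_ege1 => //; exact: F1.
Qed.

Lemma ler_prod_subset (I : finType) (A B : {set I}) (F : I -> R) :
  (forall i, 1 <= F i) -> A \subset B -> \prod_(i in A) F i <= \prod_(i in B) F i.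
Proof.
move=> F1 AB; rewrite [leRHS](big_setID A) /= (setIidPr AB).
have F0 i : 0 <= F i by apply: le_trans (F1 i).
by rewrite ler_peMr ?prodr_ge0 // prodr_ge1.
Qed.

(** Controls the loss when edge probabilities [x / (1 + x)] are replaced by [x]. The induction also
    carries the signs of the sum and of the product, which the nonlinear step needs. *)
Lemma prod_inv1D_ge (I : finType) (x : I -> R) : (forall i, 0 <= x i) ->
  1 - \sum_i x i <= \prod_i (1 + x i)^-1 <= 1.
Proof.
move=> x0; suff: (1 - \sum_i x i <= \prod_i (1 + x i)^-1 <= 1) /\
   0 <= \sum_i x i /\ 0 <= \prod_i (1 + x i)^-1 by case.
elim/big_rec2: _ => [|i p s _ [/andP[sp p1] [s0 p0]]]; first by rewrite subr0 lexx ler01.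
have xi := x0 i; set y := (1 + x i)^-1.
have yE : y * (1 + x i) = 1 by rewrite mulVf //; lra.
have y0 : 0 < y by rewrite invr_gt0; lra.
by split; [apply/andP; split|split]; nra.
Qed.

End products.

Section deterministic_bounds.
Context {R : realType}.
Variables (m n : nat) (w : 'I_n -> R).
Hypothesis w_gt0 : forall y, 0 < w y.
Local Notation I := 'I_m.+3.
Local Notation k := m.+3.
Local Notation L := (\sum_y w y).
Hypothesis L_ge1 : 1 <= L.
Implicit Types (u v : {ffun I -> 'I_n}) (i j : I).

(** The value 0 off [pairs n] turns the graph into a random subset of the whole type [{set 'I_n}]:
    any [g] containing something other than a pair gets probability 0. *)
Definition grg_prob (e : {set 'I_n}) : R := if e \in pairs n then edge_prob w e else 0.

Let L_gt0 : 0 < L. Proof. exact: lt_le_trans L_ge1. Qed.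
Let L_ge0 : 0 <= L. Proof. exact: ltW. Qed.
Let w_ge0 y : 0 <= w y. Proof. exact: ltW. Qed.

Lemma grg_prob01 e : 0 <= grg_prob e <= 1.
Proof.
rewrite /grg_prob; case: ifP => _; last by rewrite lexx ler01.
have W0 : 0 < \prod_(y in e) w y by apply: prodr_gt0.
have S0 : 0 <= \sum_y w y by apply: sumr_ge0.
have den0 : 0 < \sum_y w y + \prod_(y in e) w y by apply: ltr_wpDl.
by rewrite /edge_prob divr_ge0 ?(ltW den0) ?(ltW W0) //= ler_pdivrMr // mul1r lerDr.
Qed.

Lemma grg_cond_EhE (h : nat -> R) : grg_cond_Eh k w h =
  subset_Exp grg_prob (fun g => h (num_incl (cycles m n) g)).
Proof.
rewrite /grg_cond_Eh /subset_Exp big_mkcond; apply: eq_bigr => g _.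
rewrite powersetE; case: (boolP (g \subset pairs n)) => [gp|].
  rewrite num_cyclesE; congr (_ * _).
  rewrite /graph_prob /subset_prob big_mkcond; apply: eq_bigr => e _.
  rewrite /grg_prob; case: (boolP (e \in pairs n)) => // ep.
  by rewrite subr0; case: ifP => // /(subsetP gp); rewrite (negbTE ep).
case/subsetPn => e eg ep; rewrite /subset_prob (bigD1 e) //= eg /grg_prob.
by rewrite (negbTE ep) mul0r mulr0.
Qed.

Lemma grg_cond_Eh_le1 (h : nat -> R) :
  (forall q : nat, `|h q| <= 1) -> `|grg_cond_Eh k w h| <= 1.
Proof.
move=> h1; rewrite grg_cond_EhE; apply: le_trans (ler_norm_subset_Exp _ grg_prob01 _) _.
rewrite -[leRHS](subset_Exp_cst grg_prob).
by apply: (ler_subset_Exp _ grg_prob01) => g; exact: h1.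
Qed.

Let x v i := w (v i) * w (v (i + 1)) / L.

Let x_ge0 v i : 0 <= x v i. Proof. by rewrite divr_ge0 ?mulr_ge0. Qed.

Lemma grg_prob_edge v i : injective v ->
  grg_prob (cycle_edge m n v i) = x v i / (1 + x v i).
Proof.
move=> vI; rewrite /grg_prob.
have -> : cycle_edge m n v i \in pairs n.
  apply: (subsetP (cycle_edges_pairs _ _ _ vI)); rewrite cycle_edgesE.
  exact: imset_f.
rewrite /edge_prob big_setU1 /= ?big_set1; last first.
  rewrite inE (inj_eq vI) -subr_eq0 opprD addrA subrr add0r oppr_eq0.
  exact: oner_neq0.
rewrite /x; have := mulr_ge0 (w_ge0 (v i)) (w_ge0 (v (i + 1))).
move: (_ * _) L_gt0 => z L0 z0; field.
by rewrite !gt_eqF //; lra.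
Qed.

Lemma grg_prob_edge_le v i : injective v ->
  grg_prob (cycle_edge m n v i) <= x v i.
Proof.
move=> vI; rewrite grg_prob_edge // ler_pdivrMr; last by have := x_ge0 v i; lra.
by have := x_ge0 v i; nra.
Qed.

Let P v := incl_prob grg_prob (cycle_edges v).

Let PE v : injective v -> P v = \prod_i grg_prob (cycle_edge m n v i).
Proof.
move=> vI; rewrite /P /incl_prob cycle_edgesE big_imset //=.
by move=> i j _ _; exact: cycle_edge_inj.
Qed.

(** Each vertex of a cycle lies on two of its [k] edges, so the product of [x] over the edges is the
    product of [a] over the vertices. The factor [c] dominates 1, [w] and [w ^+ 2], hence absorbs up
    to two further occurrences of a weight; [b] is [a] times [c]. *)
Let a y := w y ^+ 2 / L.
Let c y := (1 + w y) ^+ 2.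
Let b y := w y ^+ 2 * (1 + w y) ^+ 2 / L.
Let A := \sum_y a y.
Let Q := \sum_y b y.

Let c_ge1 y : 1 <= c y.
Proof. by rewrite /c; have := w_ge0 y; nra. Qed.
Let c_ge0 y : 0 <= c y. Proof. by apply: le_trans (c_ge1 y). Qed.
Let a_ge0 y : 0 <= a y. Proof. by rewrite divr_ge0 ?sqr_ge0. Qed.
Let bE y : b y = a y * c y. Proof. by rewrite /b mulrAC. Qed.
Let b_ge0 y : 0 <= b y. Proof. by rewrite bE mulr_ge0. Qed.
Let ab y : a y <= b y. Proof. by rewrite bE ler_peMr. Qed.
Let AQ : A <= Q. Proof. exact: ler_sum. Qed.
Let A_ge0 : 0 <= A. Proof. exact: sumr_ge0. Qed.
Let Q_ge0 : 0 <= Q. Proof. exact: sumr_ge0. Qed.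

Let prod_shift (F : 'I_n -> R) v : \prod_i F (v (i + 1)) = \prod_i F (v i).
Proof. by rewrite [RHS](reindex_inj (addIr 1)). Qed.

Let prod_x v : \prod_i x v i = \prod_i a (v i).
Proof.
rewrite /x /a !big_split /= prod_shift; congr (_ * _).
Qed.

Let prod_b v : \prod_i b (v i) = \prod_i a (v i) * \prod_i c (v i).
Proof. by rewrite -big_split; apply: eq_bigr => i _; rewrite bE. Qed.

Let pair_le v i j : i != j -> w (v i) * w (v j) <= \prod_l c (v l).
Proof.
move=> ij; rewrite (bigD1 i) //= (bigD1 j) 1?eq_sym //= mulrA.
have H : 1 <= \prod_(l | (l != i) && (l != j)) c (v l) by apply: prodr_ge1.
have H2 : w (v i) * w (v j) <= c (v i) * c (v j).
  by apply: ler_pM => //; rewrite /c; nra.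
by apply: le_trans H2 _; rewrite ler_peMr // mulr_ge0.
Qed.

(** One spare edge is worth a factor [L^-1] once the weights of its two ends, which are distinct
    positions, are absorbed by [c]. *)
Let x_le v i : x v i <= L^-1 * \prod_l c (v l).
Proof.
rewrite /x mulrC ler_wpM2l ?invr_ge0 // pair_le //.
by rewrite -subr_eq0 opprD addrA subrr add0r oppr_eq0 oner_neq0.
Qed.

Let P_le v : injective v -> P v <= \prod_i a (v i).
Proof.
move=> vI; rewrite PE // -prod_x; apply: ler_prod => i _.
by rewrite grg_prob_edge_le // andbT; case/andP: (grg_prob01 (cycle_edge m n v i)).
Qed.

Let P_ge0 v : 0 <= P v. Proof. exact: incl_prob_ge0 _ grg_prob01 _. Qed.

Let sum_b : \sum_(v : {ffun I -> 'I_n}) \prod_i b (v i) = Q ^+ k.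
Proof. by rewrite sum_prod_ffun card_ord. Qed.

Let sum_inj_le (F G : {ffun I -> 'I_n} -> R) :
  (forall v, injective v -> F v <= G v) -> (forall v, 0 <= G v) ->
  \sum_(v : {ffun I -> 'I_n} | injectiveb v) F v <= \sum_(v : {ffun I -> 'I_n}) G v.
Proof.
move=> FG G0; apply: (@le_trans _ _ (\sum_(v : {ffun I -> 'I_n} | injectiveb v) G v)).
  by apply: ler_sum => v /injectiveP; exact: FG.
by rewrite [leRHS](bigID (fun v => injectiveb v)) /= lerDl sumr_ge0.
Qed.

Lemma sum_sqr_le : \sum_(v : {ffun I -> 'I_n} | injectiveb v) P v * P v <= L^-1 * Q ^+ k.
Proof.
rewrite -sum_b mulr_sumr; apply: sum_inj_le => [v vI|v]; last first.
  by rewrite mulr_ge0 ?invr_ge0 // prodr_ge0.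
(* Of the second factor [P v] only the edge at position 0 is kept; it supplies the [L^-1]. *)
rewrite prod_b mulrCA; apply: ler_pM => //; first exact: P_le.
apply: le_trans (x_le v 0); rewrite PE // (bigD1 0) //=.
apply: le_trans (grg_prob_edge_le _ 0 vI); rewrite ler_piMr //.
  by case/andP: (grg_prob01 (cycle_edge m n v 0)).
by apply: prodr_ile1 => i _; exact: grg_prob01.
Qed.

Let P_ge v : injective v ->
  \prod_i a (v i) - P v <= k%:R * (L^-1 * \prod_i b (v i)).
Proof.
move=> vI; rewrite PE //.
have -> : \prod_i grg_prob (cycle_edge m n v i) = \prod_i (x v i * (1 + x v i)^-1).
  by apply: eq_bigr => i _; rewrite grg_prob_edge.
rewrite [X in _ - X]big_split /= prod_x prod_b.
have /andP[+ _] := prod_inv1D_ge _ _ (x_ge0 v).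
have : \sum_i x v i <= k%:R * (L^-1 * \prod_i c (v i)).
  apply: (@le_trans _ _ (\sum_(i : I) L^-1 * \prod_i c (v i))).
    by apply: ler_sum => i _; exact: x_le.
  by rewrite sumr_const card_ord mulr_natl.
have : 0 <= \prod_i a (v i) by apply: prodr_ge0.
set aa := \prod_i a (v i); set cc := \prod_i c (v i).
set xx := \prod_i _; set s := \sum_i x v i => a0 sc xs.
rewrite -[X in X - _]mulr1 -mulrBr !(mulrCA _ aa) ler_wpM2l //.
by rewrite lerBlDr; move: xs; rewrite lerBlDr => /le_trans; apply; rewrite addrC lerD2r.
Qed.

Let sum_collision i j : i != j ->
  \sum_(v : {ffun I -> 'I_n} | v i == v j) \prod_l a (v l) <= L^-1 * Q ^+ k.-1.
Proof.
move=> ij.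
(* [d y] forces both colliding positions to take the value [y]. Once [y] is summed outside, the
   constraint is a product over positions, and the sum factors into [a y ^+ 2] times
   [A ^+ (k - 2)]. *)
pose d (y : 'I_n) (l : I) (z : 'I_n) : R := if (l == i) || (l == j) then (z == y)%:R else 1.
have -> : \sum_(v : {ffun I -> 'I_n} | v i == v j) \prod_l a (v l) =
    \sum_y \sum_(v : {ffun I -> 'I_n}) \prod_l (a (v l) * d y l (v l)).
  rewrite exchange_big big_mkcond; apply: eq_bigr => v _ /=.
  rewrite (bigD1 (v i)) //= [X in _ + X]big1 ?addr0; last first.
    move=> y yv; rewrite (bigD1 i) //= /d eqxx /=.
    by rewrite eq_sym (negbTE yv) mulr0 mul0r.
  case: (eqVneq (v i) (v j)) => [E|E]; last first.
    by rewrite (bigD1 j) //= /d eqxx orbT eq_sym (negbTE E) mulr0 mul0r.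
  apply: eq_bigr => l _; rewrite /d; case: ifP => [/orP[]/eqP->|_]; rewrite ?mulr1 //.
    by rewrite eqxx mulr1.
  by rewrite E eqxx mulr1.
apply: (@le_trans _ _ (\sum_y a y ^+ 2 * A ^+ m.+1)).
  apply: ler_sum => y _; rewrite (sum_prod_dffun _ _ (fun l z => a z * d y l z)).
  rewrite (bigD1 i) //= (bigD1 j) 1?eq_sym //=.
  have E l : (l == i) || (l == j) -> \sum_z a z * d y l z = a y.
    move=> lij; rewrite (bigD1 y) //= /d lij eqxx mulr1 big1 ?addr0 // => z zy.
    by rewrite (negbTE zy) mulr0.
  rewrite !E ?eqxx ?orbT // mulrA -expr2 ler_wpM2l ?sqr_ge0 //.
  rewrite (eq_bigr (fun=> A)) => [|l /andP[li lj]]; last first.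
    by apply: eq_bigr => z _; rewrite /d (negbTE li) (negbTE lj) mulr1.
  rewrite prodr_const (_ : #|_| = m.+1) //.
  have : (2 + #|[predC pred2 i j]| = m.+3)%N.
    by rewrite -[RHS](card_ord m.+3) -(cardC (pred2 i j)) card2 ij.
  move=> /eqP; rewrite add2n !eqSS => /eqP cE; apply: etrans cE.
  by apply: eq_card => l; rewrite !inE negb_or.
rewrite -mulr_suml.
have a2 y : a y ^+ 2 <= L^-1 * b y.
  rewrite /a /b -subr_ge0; have := w_ge0 y; move: (w y) (L^-1) => z l z0.
  rewrite (_ : _ - _ = (l * z) ^+ 2 * (1 + 2 * z)); last by ring.
  by rewrite mulr_ge0 ?sqr_ge0 //; lra.
have s2 : \sum_y a y ^+ 2 <= L^-1 * Q by rewrite mulr_sumr; apply: ler_sum.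
apply: (@le_trans _ _ (L^-1 * Q * Q ^+ m.+1)).
  apply: ler_pM => //; rewrite ?exprn_ge0 //; first by apply: sumr_ge0 => y _; exact: sqr_ge0.
  by rewrite lerXn2r ?nnegrE.
by rewrite -mulrA -exprS.
Qed.

(** [A ^+ k] is the sum of the products of [a] over all labelings. On injective ones the error comes
    from the denominators [1 + x] (first term); the others have two coinciding positions, handled by
    a union bound over at most [k * k] pairs (second term). *)
Lemma sum_prob_approx : `|A ^+ k - \sum_(v : {ffun I -> 'I_n} | injectiveb v) P v| <=
  L^-1 * (k%:R * Q ^+ k + (k * k)%:R * Q ^+ k.-1).
Proof.
have AE : A ^+ k = \sum_(v : {ffun I -> 'I_n}) \prod_i a (v i) by rewrite sum_prod_ffun card_ord.
rewrite AE (bigID (fun v => injectiveb v)) /= addrAC -sumrB.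
rewrite ger0_norm; last first.
  apply: addr_ge0; apply: sumr_ge0 => v.
    by move=> /injectiveP vI; rewrite subr_ge0 P_le.
  by move=> _; exact: prodr_ge0.
rewrite mulrDr; apply: lerD.
  rewrite -sum_b mulrCA mulr_sumr mulr_sumr.
  apply: sum_inj_le => [v vI|v]; first exact: P_ge.
  by rewrite !mulr_ge0 ?invr_ge0 // prodr_ge0.
apply: (@le_trans _ _ (\sum_(ij : I * I | ij.1 != ij.2)
    \sum_(v : {ffun I -> 'I_n} | v ij.1 == v ij.2) \prod_l a (v l))).
  rewrite (exchange_big_dep predT) //= [leLHS]big_mkcond; apply: ler_sum => v _.
  case: ifPn => [|_]; last by apply: sumr_ge0 => ij _; exact: prodr_ge0.
  move=> /injectivePn[i [j ij vij]].
  rewrite (bigD1 (i, j)) /=; last by rewrite ij vij eqxx.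
  by rewrite lerDl; apply: sumr_ge0 => ? _; exact: prodr_ge0.
apply: (@le_trans _ _ (\sum_(ij : I * I) L^-1 * Q ^+ k.-1)).
  rewrite [leLHS]big_mkcond; apply: ler_sum => -[i j] _ /=.
  case: ifP => ij; first exact: sum_collision.
  by rewrite mulr_ge0 ?exprn_ge0 ?invr_ge0.
by rewrite sumr_const card_prod !card_ord -[leLHS]mulr_natl mulrCA.
Qed.

Lemma new_vertex_edges u v i : u i \notin codom v ->
  cycle_edge m n u i \notin cycle_edges v /\
  cycle_edge m n u (i - 1) \notin cycle_edges v.
Proof.
have edge_codom j y : cycle_edge m n u j \in cycle_edges v ->
    y \in cycle_edge m n u j -> y \in codom v.
  rewrite [in X in X -> _]cycle_edgesE => /imsetP[l _ ->] /set2P[] ->; exact: codom_f.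
by move=> ui; split; apply: contraNN ui => /edge_codom; apply;
  rewrite /cycle_edge ?subrK ?set21 ?set22.
Qed.

(* A vertex of [u] outside [v] has both of its edges outside the cycle [v], and
   some edge of [u] outside the cycle of [v] starts at a vertex of [v]; hence
   the union of the two cycles has more edges than vertices. *)
Lemma new_edges_gt_new_vertices u v : injective u -> injective v ->
  cycle_edges u != cycle_edges v -> cycle_edges v :&: cycle_edges u != finset.set0 ->
  (#|[set i | u i \notin codom v]| <
   #|[set i | cycle_edge m n u i \notin cycle_edges v]|)%N.
Proof.
move=> uI vI neq meet; set F := [set i | _]; set M := [set i | _].
have FM i : i \in F -> i \in M by rewrite !inE => /new_vertex_edges[].
have FM' i : i \in F -> i - 1 \in M by rewrite !inE => /new_vertex_edges[].
rewrite ltnNge; apply/negP => MF.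
(* If [F = M], then [M] is stable under [i - 1], hence empty or everything. Empty would make the two
   cycles equal; everything would make them edge-disjoint. *)
have /eqP FMe : F == M by rewrite eqEcard MF andbT; apply/subsetP.
have step i : i \in M -> i - 1 \in M by rewrite -{1}FMe; exact: FM'.
case/set0Pn: meet => e /setIP[ev]; rewrite cycle_edgesE => /imsetP[i _ eE].
have iM : i \notin M by rewrite inE negbK -eE.
have [M0|[j jM]] := set_0Vmem M.
  case/negP: neq; rewrite eqEcard !card_cycle_edges // leqnn andbT.
  rewrite (cycle_edgesE m n u); apply/subsetP => _ /imsetP[j _ ->].
  by apply: contraT => H; move: (in_set0 j); rewrite -M0 inE H.
case/negP: iM.
have all (t : nat) : j - t%:R \in M.
  by elim: t => [|t IH]; [rewrite subr0|rewrite -natr1 opprD addrA step].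
by have := all (j - i : I); rewrite natr_Zp opprB addrC subrK.
Qed.

(** Count weights over the new edges of [u]. A vertex off [v] has both its edges new and contributes
    [w ^+ 2]; a vertex on [v] contributes at most [w ^+ 2], absorbed by its [c], and these vertices
    are distinct. The right side replaces [a] over the new positions by a product over all
    positions, so that the sum over [u] will factor. *)
Let joint_le u v : injective u -> injective v ->
  cycle_edges u != cycle_edges v -> cycle_edges v :&: cycle_edges u != finset.set0 ->
  P v * incl_prob grg_prob (cycle_edges u :\: cycle_edges v) <=
  L^-1 * \prod_j b (v j) * \prod_i ((u i \in codom v)%:R + a (u i)).
Proof.
move=> uI vI neq meet.
have := new_edges_gt_new_vertices _ _ uI vI neq meet.
set F := [set i | _]; set M := [set i | _] => ltFM.
have FM i : i \in F -> i \in M by rewrite !inE => /new_vertex_edges[].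
have FM' i : i \in F -> i - 1 \in M by rewrite !inE => /new_vertex_edges[].
rewrite prod_b.
have -> : incl_prob grg_prob (cycle_edges u :\: cycle_edges v) =
    \prod_(i in M) grg_prob (cycle_edge m n u i).
  rewrite -[RHS](big_imset (h := cycle_edge m n u)) /=; last first.
    by move=> i j _ _; exact: cycle_edge_inj.
  apply: eq_bigl => e; rewrite inE; apply/andP/imsetP.
    by rewrite [in X in _ /\ X]cycle_edgesE => -[ev /imsetP[i _ eE]]; exists i; rewrite // inE -eE.
  by case=> i; rewrite inE => iM ->; split=> //; rewrite cycle_edgesE imset_f.
have main : \prod_(i in M) grg_prob (cycle_edge m n u i) <=
    L^-1 * \prod_j c (v j) * \prod_(i in F) a (u i).
  apply: (@le_trans _ _ (\prod_(i in M) x u i)).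
    apply: ler_prod => i _; rewrite grg_prob_edge_le // andbT.
    by case/andP: (grg_prob01 (cycle_edge m n u i)).
  have -> : \prod_(i in M) x u i =
     \prod_i (w (u i) ^+ (i \in M) * w (u i) ^+ (i - 1 \in M)) / L ^+ #|M|.
    rewrite /x big_split /= prodr_const exprVn; congr (_ / _).
    rewrite !big_split /=; congr (_ * _).
      by rewrite big_mkcond; apply: eq_bigr => i _; case: ifP.
    rewrite [RHS](reindex_inj (addIr 1)) big_mkcond; apply: eq_bigr => i _.
    by rewrite addrK; case: ifP.
  have split_le : \prod_i (w (u i) ^+ (i \in M) * w (u i) ^+ (i - 1 \in M)) <=
      \prod_j c (v j) * \prod_(i in F) (w (u i)) ^+ 2.
    rewrite (bigID (mem F)) /= mulrC; apply: ler_pM.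
    - by apply: prodr_ge0 => i _; rewrite mulr_ge0 ?exprn_ge0.
    - by apply: prodr_ge0 => i _; rewrite mulr_ge0 ?exprn_ge0.
    - apply: (@le_trans _ _ (\prod_(i in ~: F) c (u i))).
        rewrite [leRHS](eq_bigl (fun i => i \notin F)); last by move=> i; rewrite !inE.
        apply: ler_prod => i _; rewrite mulr_ge0 ?exprn_ge0 //=.
        by rewrite /c; have := w_ge0 (u i); case: (i \in M); case: (_ \in M);
           rewrite ?expr0 ?expr1; nra.
      rewrite -[leLHS](big_imset (h := u) c) /=; last by move=> i j _ _ /uI.
      have -> : \prod_j c (v j) = \prod_(y in [set v j | j : I]) c y.
        by rewrite big_imset //= => i j _ _ /vI.
      apply: ler_prod_subset => //; apply/subsetP => y /imsetP[i].
      rewrite !inE negbK => /codomP[j ->] ->; exact: imset_f.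
    - apply: ler_prod => i iF; rewrite mulr_ge0 ?exprn_ge0 //=.
      by rewrite FM // FM' // expr1 -expr2.
  have -> : \prod_(i in F) a (u i) = \prod_(i in F) w (u i) ^+ 2 * (L ^+ #|F|)^-1.
    by rewrite /a big_split /= prodr_const exprVn.
  rewrite [leRHS](_ : _ = (\prod_j c (v j) * \prod_(i in F) w (u i) ^+ 2) *
    (L ^- #|F| / L)); last by ring.
  apply: ler_pM.
  - by apply: prodr_ge0 => i _; rewrite mulr_ge0 ?exprn_ge0.
  - by rewrite invr_ge0 exprn_ge0.
  - exact: split_le.
  (* The surplus of new edges over new vertices gives the extra [L^-1], thanks to [1 <= L]. *)
  rewrite -invfM -exprSr lef_pV2 ?posrE ?exprn_gt0 //.
  by rewrite ler_weXn2l.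
apply: (@le_trans _ _ (\prod_j a (v j) * (L^-1 * \prod_j c (v j) * \prod_(i in F) a (u i)))).
  apply: ler_pM => //; last exact: P_le.
  by apply: prodr_ge0 => i _; case/andP: (grg_prob01 (cycle_edge m n u i)).
rewrite !mulrA [_ * L^-1]mulrC; apply: ler_wpM2l.
  by rewrite !mulr_ge0 ?invr_ge0 ?prodr_ge0.
rewrite big_mkcond; apply: ler_prod => i _; rewrite inE.
by case: (u i \in codom v); rewrite /= ?ler01 ?lerDl ?add0r ?a_ge0 ?lexx.
Qed.

(** For fixed [v] the sum over [u] of the bound in [joint_le] factors into the [k]-th power of
    [#|codom v| + A], that is [k + A], at most [k + Q]. *)
Lemma sum_joint_le :
  \sum_(v : {ffun I -> 'I_n} | injectiveb v)
    P v * (\sum_(C' in cycles m n |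
        (C' != cycle_edges v) && (cycle_edges v :&: C' != finset.set0))
       incl_prob grg_prob (C' :\: cycle_edges v))
  <= L^-1 * ((k%:R + Q) ^+ k * Q ^+ k).
Proof.
rewrite -sum_b mulr_sumr mulr_sumr; apply: sum_inj_le => [v vI|v]; last first.
  apply: mulr_ge0; first by rewrite invr_ge0.
  apply: mulr_ge0; last exact: prodr_ge0.
  by apply: exprn_ge0; apply: addr_ge0.
rewrite big_mkcondr /=.
apply: le_trans (ler_wpM2l (P_ge0 v) (sum_cycles_le _ _ _ _ _)) _.
  by move=> C; case: ifP => // _; exact: incl_prob_ge0 _ grg_prob01 _.
rewrite mulr_sumr.
apply: (@le_trans _ _ (\sum_(u : {ffun I -> 'I_n}) L^-1 * \prod_j b (v j) *
    \prod_i ((u i \in codom v)%:R + a (u i)))).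
  apply: sum_inj_le => [u uI|u]; last first.
    rewrite !mulr_ge0 ?invr_ge0 ?prodr_ge0 // => i _; exact: addr_ge0.
  case: ifP => [/andP[neq meet]|_]; first exact: joint_le.
  rewrite mulr0 !mulr_ge0 ?invr_ge0 ?prodr_ge0 // => i _; exact: addr_ge0.
rewrite -mulr_sumr (sum_prod_ffun _ _ (fun y => (y \in codom v)%:R + a y)) card_ord.
rewrite -mulrA ler_wpM2l ?invr_ge0 // mulrC ler_wpM2r ?prodr_ge0 //.
apply: lerXn2r; rewrite ?nnegrE.
- by apply: sumr_ge0 => y _; exact: addr_ge0.
- exact: addr_ge0.
rewrite big_split; apply: lerD => //.
rewrite -natr_sum -[X in X%:R](_ : #|codom v| = _).
  by rewrite card_codom // card_ord.
by rewrite -sum1_card big_mkcond; apply: eq_bigr => y _; case: ifP.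
Qed.

(** The first two terms come from inserting [A ^+ k / (2 * k)] between [lam] and the conditional
    mean, the third from the local dependence, with cycles replaced by their labelings. *)
Lemma grg_stein_bound (lam B mu : R) (f h : nat -> R) :
  (forall q : nat, `|f q| <= B) ->
  (forall q : nat, lam * f q.+1 - q%:R * f q = h q - mu) ->
  let A := (\sum_y w y ^+ 2) / L in
  let Q := (\sum_y w y ^+ 2 * (1 + w y) ^+ 2) / L in
  `|grg_cond_Eh k w h - mu| <=
  B * `|lam - A ^+ k / (2 * k)%:R| +
  B * (L^-1 * (k%:R * Q ^+ k + (k * k)%:R * Q ^+ k.-1)) +
  2 * B * (L^-1 * (Q ^+ k + (k%:R + Q) ^+ k * Q ^+ k)).
Proof.
move=> fB fh; cbv zeta.
have <- : A = (\sum_y w y ^+ 2) / L by rewrite mulr_suml.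
have <- : Q = (\sum_y w y ^+ 2 * (1 + w y) ^+ 2) / L by rewrite mulr_suml.
have B0 : 0 <= B := le_trans (normr_ge0 _) (fB 0%N).
have -> : grg_cond_Eh k w h - mu = subset_Exp grg_prob (fun g =>
    lam * f (num_incl (cycles m n) g).+1 -
    (num_incl (cycles m n) g)%:R * f (num_incl (cycles m n) g)).
  rewrite grg_cond_EhE -[X in _ - X](subset_Exp_cst grg_prob) -[X in _ + X]mulN1r.
  rewrite -subset_ExpZ -subset_ExpD; apply: eq_bigr => g _.
  by rewrite fh mulN1r.
apply: le_trans (stein_subset_bound _ grg_prob01 (cycles m n) lam B f fB) _.
have k2 : 1 <= (2 * k)%:R :> R by rewrite ler1n.
apply: lerD.
  rewrite -mulrDr; apply: ler_wpM2l => //.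
  have := sum_prob_approx; rewrite (sum_labelings m n R (incl_prob grg_prob)).
  set S := \sum_(C in _) _; set Z := L^-1 * _ => H.
  rewrite -(subrK (A ^+ k / (2 * k)%:R) lam) -addrA.
  apply: le_trans (ler_normD _ _) _; rewrite lerD // ?subrK //.
  have -> : A ^+ k / (2 * k)%:R - S = (A ^+ k - (2 * k)%:R * S) / (2 * k)%:R.
    by field; rewrite gt_eqF //; lra.
  rewrite normrM normfV [X in _ / X]ger0_norm; last by lra.
  rewrite ler_pdivrMr; last by lra.
  apply: le_trans H _; rewrite ler_peMr //.
  apply: mulr_ge0; first by rewrite invr_ge0.
  by apply: addr_ge0; apply: mulr_ge0 => //; exact: exprn_ge0.
apply: ler_wpM2l; first by rewrite mulr_ge0.
apply: le_trans (sum_cycles_le _ _ _ _ _) _.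
  move=> C; rewrite mulr_ge0 ?addr_ge0 ?(incl_prob_ge0 _ grg_prob01) //.
  by apply: sumr_ge0 => C' _; exact: incl_prob_ge0 _ grg_prob01 _.
under eq_bigr do rewrite mulrDr.
by rewrite big_split mulrDr lerD //; [exact: sum_sqr_le|exact: sum_joint_le].
Qed.

End deterministic_bounds.

(** * From fixed weights to empirical averages *)

Ltac nneg := repeat first [done | assumption
  | apply: ltW; assumption | apply: exprn_ge0 | rewrite invr_ge0 | apply: addr_ge0
  | apply: mulr_ge0].

Definition weight4 {R : realType} (y : R) : R := y ^+ 2 * (1 + y) ^+ 2.

Section pointwise_bound.
Context {R : realType}.

Lemma ler_dist_exp (a b q : R) j : 0 <= a <= q -> 0 <= b <= q ->
  `|a ^+ j.+1 - b ^+ j.+1| <= j.+1%:R * q ^+ j * `|a - b|.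
Proof.
move=> /andP[a0 aq] /andP[b0 bq]; rewrite subrXX normrM mulrC ler_wpM2r //.
apply: le_trans (ler_norm_sum _ _ _) _.
apply: (@le_trans _ _ (\sum_(i < j.+1) q ^+ j)); last first.
  by rewrite sumr_const card_ord mulr_natl.
apply: ler_sum => i _; rewrite normrM !normrX !ger0_norm //.
have ij : (i <= j)%N by rewrite -ltnS.
rewrite -[in leRHS](subnK ij) exprD /=.
by apply: ler_pM; rewrite ?exprn_ge0 ?lerXn2r ?nnegrE //; apply: le_trans aq.
Qed.

Variables (m n : nat) (w : 'I_n -> R).
Hypothesis w_gt0 : forall y, 0 < w y.
Local Notation k := m.+3.

(** When the mean weight is at least [m1 / 2] and the mean of [weight4] at most [M], [Q] is at most
    [q = 2 * M / m1] and [L^-1] at most [2 / m1 / n]. This is the coefficient of [1 / n] that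
    results. *)
Definition good_const (m1 M B : R) : R :=
  let q := 2 * M / m1 in
  2 / m1 * (B * (k%:R * q ^+ k + (k * k)%:R * q ^+ k.-1) +
  2 * B * (q ^+ k + (k%:R + q) ^+ k * q ^+ k)).

(** [q ^+ (k - 1)] is a Lipschitz constant of [x ^+ k / (2 * k)] on [[0, q]]; the last factor is one
    for the ratio of the two averages around [m2 / m1], given a denominator at least [m1 / 2]. *)
Definition slope_const (m1 m2 M B : R) : R :=
  B * (2 * M / m1) ^+ k.-1 * (2 * (m1 + m2) / m1 ^+ 2).

(** The 2 pays for the trivial bound when some term is at least 1. The [8 / m1 ^+ 2] pays for it
    when the mean weight is below [m1 / 2], where its squared deviation is at least [m1 ^+ 2 / 4].
    The factor 2 before the slope counts the two averages. *)
Definition pointwise_const (m1 m2 M B : R) : R :=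
  2 + 8 / m1 ^+ 2 + good_const m1 M B + 2 * slope_const m1 m2 M B.

Local Notation avg g := ((\sum_i g (w i)) / n%:R).
Local Notation phi := (@weight4 R).

Variables (m1 m2 M B mu : R) (f h : nat -> R).
Let lam : R := (m2 / m1) ^+ k / (2 * k)%:R.
Hypotheses (m1_gt0 : 0 < m1) (m2_ge0 : 0 <= m2) (m2M : m2 <= M).
Hypothesis fB : forall j, `|f j| <= B.
Hypothesis fh : forall j, lam * f j.+1 - j%:R * f j = h j - mu.

Let M_ge0 : 0 <= M. Proof. exact: le_trans m2M. Qed.
Let B_ge0 : 0 <= B. Proof. exact: le_trans (normr_ge0 _) (fB 0%N). Qed.
Let q_ge0 : 0 <= 2 * M / m1. Proof. by rewrite divr_ge0 ?mulr_ge0 // ltW. Qed.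

Lemma good_const_ge0 : 0 <= good_const m1 M B.
Proof.
by rewrite /good_const; cbv zeta; nneg.
Qed.

Lemma slope_const_ge0 : 0 <= slope_const m1 m2 M B.
Proof.
by rewrite /slope_const; nneg.
Qed.

Let good_case : (0 < n)%N -> 2 <= m1 * n%:R -> m1 / 2 <= avg id -> avg phi <= M ->
  `|grg_cond_Eh k w h - mu| <= good_const m1 M B / n%:R +
   slope_const m1 m2 M B * (`|avg id - m1| + `|avg (fun y => y ^+ 2) - m2|).
Proof.
move=> n_gt0 n_large; set A1 := avg id; set A2 := avg (fun y => y ^+ 2) => A1m QM.
have nR : 0 < n%:R :> R by rewrite ltr0n.
have L_E : \sum_y w y = A1 * n%:R by rewrite /A1 divfK ?gt_eqF.
have A1_gt0 : 0 < A1 by apply: lt_le_trans A1m; rewrite divr_gt0.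
have L_ge1 : 1 <= \sum_y w y.
  rewrite L_E; apply: (@le_trans _ _ (m1 / 2 * n%:R)); first by lra.
  by rewrite ler_wpM2r // ltW.
have := grg_stein_bound m n w w_gt0 L_ge1 lam B mu f h fB fh.
cbv zeta; set A := (\sum_y w y ^+ 2) / _.
set Q := (\sum_y w y ^+ 2 * (1 + w y) ^+ 2) / _.
set q := 2 * M / m1.
have w0 y : 0 <= w y by exact: ltW.
have AE : A = A2 / A1.
  rewrite /A L_E /A2; field.
  by rewrite !gt_eqF.
have QE : Q = avg phi / A1.
  rewrite /Q L_E; field.
  by rewrite !gt_eqF.
have Ainv : A1^-1 <= 2 / m1.
  have m12 : 0 < m1 / 2 by rewrite divr_gt0.
  by rewrite -[2 / m1]invf_div lef_pV2.
have Q0 : 0 <= Q.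
  rewrite divr_ge0 //; last by lra.
  by apply: sumr_ge0 => y _; rewrite mulr_ge0 ?sqr_ge0.
have Qq : Q <= q.
  rewrite QE /q mulrC mulrAC (mulrC _ M) [leRHS]mulrC; apply: ler_pM => //.
    by rewrite invr_ge0 ltW.
  apply: mulr_ge0; rewrite ?invr_ge0 ?(ltW nR) //.
  by apply: sumr_ge0 => y _; rewrite mulr_ge0 ?sqr_ge0.
have A0 : 0 <= A.
  rewrite divr_ge0 //; last by lra.
  by apply: sumr_ge0 => y _; exact: sqr_ge0.
have AQ : A <= Q.
  apply: ler_wpM2r; first by rewrite invr_ge0; lra.
  by apply: ler_sum => y _; rewrite ler_peMr ?sqr_ge0 //; have := w0 y; nra.
have m2q : m2 / m1 <= q.
  rewrite /q; apply: ler_wpM2r; first by rewrite invr_ge0 ltW.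
  by have := M_ge0; have := m2M; lra.
have m2m1 : 0 <= m2 / m1 by rewrite divr_ge0 // ltW.
have kR : 0 < (2 * k)%:R :> R by rewrite ltr0n.
have slope : B * `|lam - A ^+ k / (2 * k)%:R| <=
    slope_const m1 m2 M B * (`|A1 - m1| + `|A2 - m2|).
  rewrite /lam -mulrBl normrM [X in _ * (_ * X)]gtr0_norm ?invr_gt0 //.
  have ratio : `|m2 / m1 - A| <= 2 * (m1 + m2) / m1 ^+ 2 * (`|A1 - m1| + `|A2 - m2|).
    have -> : m2 / m1 - A = (m1 * (m2 - A2) + m2 * (A1 - m1)) / m1 / A1.
      by rewrite AE; field; rewrite !gt_eqF.
    rewrite !normrM !normfV (gtr0_norm m1_gt0) (gtr0_norm A1_gt0).
    have num : `|m1 * (m2 - A2) + m2 * (A1 - m1)| <= (m1 + m2) * (`|A1 - m1| + `|A2 - m2|).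
      apply: le_trans (ler_normD _ _) _.
      rewrite !normrM (gtr0_norm m1_gt0) (ger0_norm m2_ge0) (distrC m2).
      have := mulr_ge0 (ltW m1_gt0) (normr_ge0 (A1 - m1)).
      by have := mulr_ge0 m2_ge0 (normr_ge0 (A2 - m2)); lra.
    apply: (@le_trans _ _ ((m1 + m2) * (`|A1 - m1| + `|A2 - m2|) / m1 * (2 / m1))).
      apply: ler_pM => //; rewrite ?invr_ge0 ?(ltW A1_gt0) //.
        by rewrite mulr_ge0 // invr_ge0 ltW.
      by rewrite ler_wpM2r // invr_ge0 ltW.
    by rewrite le_eqVlt; apply/orP; left; apply/eqP; field; rewrite gt_eqF.
  have := ler_dist_exp (m2 / m1) A q k.-1.
  rewrite m2m1 m2q A0 (le_trans AQ Qq) => /(_ isT isT) expd.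
  rewrite [leRHS](_ : _ = B * (q ^+ k.-1 *
      (2 * (m1 + m2) / m1 ^+ 2 * (`|A1 - m1| + `|A2 - m2|)))); last first.
    by rewrite /slope_const -/q -[LHS]mulrA -[LHS]mulrA.
  rewrite ler_wpM2l //.
  apply: (@le_trans _ _ (k%:R * q ^+ k.-1 * `|m2 / m1 - A| / (2 * k)%:R)).
    by rewrite ler_wpM2r // invr_ge0 ltW.
  have -> : k%:R * q ^+ k.-1 * `|m2 / m1 - A| / (2 * k)%:R =
      q ^+ k.-1 * (`|m2 / m1 - A| / 2).
    rewrite natrM; move: (q ^+ _) `|_| (k%:R : R) (pnatr_eq0 R k) => x y z z0.
    by field; rewrite z0.
  rewrite ler_wpM2l ?exprn_ge0 //.
  apply: (@le_trans _ _ `|m2 / m1 - A|); last exact: ratio.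
  by have := normr_ge0 (m2 / m1 - A); lra.
move=> /le_trans; apply; rewrite -[leLHS]addrA [leLHS]addrC; apply: lerD; last exact: slope.
have Linv : (\sum_y w y)^-1 <= 2 / m1 / n%:R.
  by rewrite L_E invfM ler_wpM2r // invr_ge0 ltW.
have Linv0 : 0 <= (\sum_y w y)^-1 by rewrite invr_ge0; lra.
rewrite /good_const -/q [leRHS]mulrAC [leRHS]mulrDr; apply: lerD.
  rewrite [leLHS]mulrCA; apply: ler_pM => //.
    by nneg.
  rewrite ler_wpM2l //; apply: lerD; apply: ler_wpM2l => //; exact: lerXn2r.
rewrite [leLHS]mulrCA; apply: ler_pM => //.
  by nneg.
rewrite ler_wpM2l ?mulr_ge0 //; apply: lerD; first exact: lerXn2r.
have kQ : k%:R + Q <= k%:R + q by rewrite lerD2l.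
have kQ0 : 0 <= k%:R + Q by rewrite addr_ge0.
apply: ler_pM; [by rewrite exprn_ge0|by rewrite exprn_ge0| |exact: lerXn2r].
by rewrite lerXn2r // nnegrE; apply: le_trans kQ.
Qed.

(* The first, third and fourth terms also account for the events that the
   empirical mean of [w] is small, that the truncated empirical mean of
   [weight4] is large, and that some weight exceeds [t]. *)
Lemma pointwise_bound (t s mt : R) : (0 < n)%N -> 2 <= m1 * n%:R ->
  0 <= t -> 0 < s -> s ^+ 2 = n%:R -> t ^+ 6 = n%:R * s -> 1 <= s ->
  mt <= M - 1 -> (forall j, `|h j| <= 1) -> `|mu| <= 1 ->
  `|grg_cond_Eh k w h - mu| <= pointwise_const m1 m2 M B *
   (s * (avg id - m1) ^+ 2 + s * (avg (fun y => y ^+ 2) - m2) ^+ 2 +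
    (avg (fun y => phi y * (y <= t)%R%:R) - mt) ^+ 2 +
    (\sum_i w i ^+ 6) / (n%:R * s) + s^-1).
Proof.
move=> n_gt0 n_large t_ge0 s_gt0 s2 t6 s_ge1 mtM h1 mu1.
set A1 := avg id; set A2 := avg (fun y => y ^+ 2).
set Bt := avg (fun y => phi y * (y <= t)%R%:R).
set S6 := (\sum_i w i ^+ 6) / (n%:R * s).
have nR : 0 < n%:R :> R by rewrite ltr0n.
have w0 y : 0 <= w y by exact: ltW.
have a1 : 0 <= s * (A1 - m1) ^+ 2 by rewrite mulr_ge0 ?sqr_ge0 // ltW.
have a2 : 0 <= s * (A2 - m2) ^+ 2 by rewrite mulr_ge0 ?sqr_ge0 // ltW.
have a3 : 0 <= (Bt - mt) ^+ 2 by rewrite sqr_ge0.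
have a4 : 0 <= S6.
  rewrite divr_ge0 //; first by apply: sumr_ge0 => i _; rewrite exprn_ge0.
  by rewrite mulr_ge0 // ltW.
have a5 : 0 <= s^-1 by rewrite invr_ge0 ltW.
set Z := _ + s^-1.
have Z0 : 0 <= Z by rewrite /Z; lra.
have g0 := good_const_ge0; have sl0 := slope_const_ge0.
have e0 : 0 <= 8 / m1 ^+ 2 by rewrite divr_ge0 // sqr_ge0.
have D2 : `|grg_cond_Eh k w h - mu| <= 2.
  apply: le_trans (ler_normB _ _) _.
  by have := grg_cond_Eh_le1 m n w w_gt0 h h1; lra.
case: (boolP [forall i, w i <= t]) => [/forallP wt|]; last first.
  rewrite negb_forall => /existsP[i]; rewrite -ltNge => ti.
  have S1 : 1 <= S6.
    rewrite ler_pdivlMr ?mulr_gt0 // mul1r -t6 (bigD1 i) //=.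
    rewrite -[leLHS]addr0; apply: lerD; last by apply: sumr_ge0 => j _; rewrite exprn_ge0.
    by rewrite lerXn2r ?nnegrE // ltW.
  apply: le_trans D2 _; rewrite -[leLHS]mulr1; apply: ler_pM => //.
    by rewrite /pointwise_const; lra.
  by rewrite /Z; lra.
have [A1s|A1g] := ltP A1 (m1 / 2).
  have : m1 ^+ 2 / 4 <= s * (A1 - m1) ^+ 2.
    apply: (@le_trans _ _ ((A1 - m1) ^+ 2)); last by rewrite ler_peMl ?sqr_ge0.
    have x0 : 0 <= m1 / 2 - A1 by rewrite subr_ge0 ltW.
    have -> : (A1 - m1) ^+ 2 = m1 ^+ 2 / 4 + (m1 / 2 - A1) ^+ 2 + (m1 / 2 - A1) * m1.
      by field.
    by rewrite -addrA lerDl addr_ge0 ?sqr_ge0 // mulr_ge0 // ltW.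
  move=> big; apply: le_trans D2 _.
  apply: (@le_trans _ _ (8 / m1 ^+ 2 * (m1 ^+ 2 / 4))).
    by rewrite le_eqVlt; apply/orP; left; apply/eqP; field; rewrite gt_eqF.
  apply: ler_pM => //; first by rewrite divr_ge0 // sqr_ge0.
    by rewrite /pointwise_const; lra.
  by rewrite /Z; lra.
have [Bs|Bg] := leP Bt M; last first.
  apply: le_trans D2 _; rewrite -[leLHS]mulr1; apply: ler_pM => //.
    by rewrite /pointwise_const; lra.
  suff : 1 <= (Bt - mt) ^+ 2 by rewrite /Z; lra.
  by rewrite -[leLHS](expr1n _ 2) lerXn2r ?nnegrE //; lra.
have BtE : Bt = avg phi.
  rewrite /Bt; congr (_ / _); apply: eq_bigr => i _.
  by rewrite wt mulr1.
apply: le_trans (good_case n_gt0 n_large A1g _) _; first by rewrite -BtE.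
(* Converts first-order fluctuations into second moments. With [s] the root of [n] and a variance of
   order [1 / n], both terms integrate to order [1 / s]. *)
have amgm a : `|a| <= s * a ^+ 2 + s^-1.
  have ss : s * s^-1 = 1 by rewrite mulfV ?gt_eqF.
  have : 0 <= s^-1 * (s * `|a| - 1) ^+ 2 by rewrite mulr_ge0 ?sqr_ge0.
  rewrite (_ : s^-1 * _ = (s * s^-1) * (s * `|a| ^+ 2) - (s * s^-1) * (2 * `|a|) + s^-1); last by ring.
  by rewrite ss real_normK ?num_real //; have := normr_ge0 a; lra.
have nz : n%:R^-1 <= Z.
  apply: (@le_trans _ _ s^-1); last by rewrite /Z; lra.
  by rewrite lef_pV2 ?posrE // -s2 expr2 ler_peMr // ltW.
have amgm2 : `|A1 - m1| + `|A2 - m2| <= 2 * Z.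
  by have := amgm (A1 - m1); have := amgm (A2 - m2); rewrite /Z; lra.
apply: (@le_trans _ _ (good_const m1 M B * Z + slope_const m1 m2 M B * (2 * Z))).
  by apply: lerD; apply: ler_wpM2l.
by rewrite /pointwise_const; nra.
Qed.

End pointwise_bound.

(* Imported only here: the names of many lemmas on [{set T}] are shadowed by
   their counterparts for classical sets. *)
From mathcomp Require Import all_classical all_reals all_analysis.
From mathcomp Require Import measurable_realfun.
Import numFieldNormedType.Exports.
Local Open Scope classical_set_scope.
Local Open Scope ring_scope.

(** * The Stein equation *)

Section stein.
Context {R : realType}.
Variables (lam : R) (h : nat -> R).
Hypotheses (lam_gt0 : 0 < lam) (h_le1 : forall m, `|h m| <= 1).

Let term_cvg (u : R^nat) (c : R) : (forall i, `|u i| <= c * exp_coeff lam i) ->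
  cvgn (series u) /\ `|limn (series u)| <= c * expR lam.
Proof.
move=> uc.
have cvgc : cvgn (series (fun i => c * exp_coeff lam i)).
  exact: (@is_cvg_seriesZ _ _ c (is_cvg_series_exp_coeff lam)).
have cvgn : cvgn [normed series u].
  by apply: series_le_cvg cvgc => [i|i|//] /=; [|apply: le_trans (normr_ge0 _) (uc i)].
split; first exact: normed_cvg.
apply: le_trans (lim_series_norm cvgn) _.
apply: le_trans (lim_series_le cvgn cvgc uc) _.
by rewrite (@lim_seriesZ _ _ c (is_cvg_series_exp_coeff lam)).
Qed.

Lemma lim_seriesS (u v : R^nat) (a c : R) : cvgn (series v) -> u 0%N = a ->
  (forall i, u i.+1 = c * v i) -> limn (series u) = a + c * limn (series v).
Proof.
move=> cv u0 uS; apply/cvg_lim => //.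
rewrite -(cvg_shiftS (series u)) /=.
rewrite (_ : (fun n => _) = (fun n => a + c * series v n)).
  by apply: cvgD; [exact: cvg_cst|apply: cvgM => //; exact: cvg_cst].
apply/funext => n; rewrite /series /= big_nat_recl //= u0; congr (_ + _).
by rewrite big_distrr; apply: eq_bigr => i _; rewrite uS.
Qed.

Let pmfE i : poisson_pmf lam i = expR (- lam) * exp_coeff lam i.
Proof. by rewrite /poisson_pmf lam_gt0 /exp_coeff /= mulrC. Qed.

Let h_pmf_le i : `|h i * poisson_pmf lam i| <= expR (- lam) * exp_coeff lam i.
Proof.
rewrite normrM -pmfE [X in _ * X]ger0_norm ?poisson_pmf_ge0//.
by rewrite ler_piMl ?poisson_pmf_ge0.
Qed.

Let mu := poisson_Eh lam h.

Lemma poisson_Eh_le1 : `|mu| <= 1.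
Proof. by have [_] := term_cvg _ _ h_pmf_le; rewrite -expRD addNr expR0. Qed.

Let g j := h j - mu.

Let g_le2 j : `|g j| <= 2.
Proof.
apply: le_trans (ler_normB _ _) _.
by have := h_le1 j; have := poisson_Eh_le1; lra.
Qed.

(** Terms of [(m-1)! / lam^m] times the tail of [lam^j / j! * g j] from [j = m] on, with
    [j = m + i]. Since [(m-1)! i! <= (m+i)!], they are dominated by the exponential series. At
    [m = 0] the truncated predecessor gives [0! = 1], and the Stein equation multiplies that value
    of the solution by 0. *)
Let a m i : R := (m.-1)`!%:R * lam ^+ i / (m + i)`!%:R * g (m + i)%N.

Let a_le m i : `|a m i| <= 2 * exp_coeff lam i.
Proof.
have f0 n : 0 < n`!%:R :> R by rewrite ltr0n fact_gt0.
rewrite /a normrM mulrC ler_pM //.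
rewrite ger0_norm; last by rewrite divr_ge0 ?mulr_ge0 ?ler0n ?exprn_ge0 ?ltW.
rewrite /exp_coeff /= mulrAC mulrC ler_pM2l ?exprn_gt0 //.
rewrite ler_pdivrMr // mulrC ler_pdivlMr // -natrM ler_nat.
rewrite -(@bin_fact (m + i) i) ?leq_addl // addnK.
apply: (@leq_trans (i`! * m`!)); first by rewrite mulnC leq_mul2l leq_fact ?orbT ?leq_pred.
by rewrite leq_pmull // bin_gt0 leq_addl.
Qed.

Let cvga m : cvgn (series (a m)). Proof. by case: (term_cvg _ _ (a_le m)). Qed.

(* Writing the solution as a tail sum bounds it uniformly in [m]. *)
Lemma stein_solution : exists f : nat -> R,
  (forall m, `|f m| <= 2 * expR lam) /\
  (forall m, lam * f m.+1 - m%:R * f m = h m - poisson_Eh lam h).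
Proof.
exists (fun m => - limn (series (a m))); split.
  by move=> m; rewrite normrN; case: (term_cvg _ _ (a_le m)).
case=> [|m].
  (* At [m = 0] the equation fixes the value of [f 1]. The tail sum attains it because the full
     series is [expR lam] times the Poisson mean of [g], which is 0 by the choice of [mu]. *)
  have E : limn (series (fun i => exp_coeff lam i * g i)) =
      g 0%N + lam * limn (series (a 1)).
    apply: lim_seriesS => //; first by rewrite /exp_coeff /= fact0 expr0; lra.
    by move=> i; rewrite /a /exp_coeff /= add1n exprS fact0 !mulrA mulr1.
  rewrite mul0r subr0; suff Z : limn (series (fun i => exp_coeff lam i * g i)) = 0.
    rewrite mulrN -/mu -/(g 0%N); move: E; rewrite Z => /eqP.
    by rewrite eq_sym addr_eq0 => /eqP ->.
  have C : cvgn (series (fun i => h i * poisson_pmf lam i)).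
    by case: (term_cvg _ _ h_pmf_le).
  apply/cvg_lim => //.
  rewrite (_ : series _ = fun n => expR lam * series (fun i => h i * poisson_pmf lam i) n
      - mu * series (exp_coeff lam) n).
    rewrite -[X in _ --> X](_ : expR lam * mu - mu * expR lam = 0); last by rewrite mulrC subrr.
    apply: cvgB; apply: cvgM; try exact: cvg_cst; first exact: C.
    exact: is_cvg_series_exp_coeff.
  apply/funext => n; rewrite /series /= !big_distrr -sumrB.
  apply: eq_bigr => i _; rewrite pmfE /g expRN.
  have /lt0r_neq0 e0 := expR_gt0 lam.
by rewrite /=; field.
have f0 n : n`!%:R != 0 :> R by rewrite pnatr_eq0 -lt0n fact_gt0.
have m0 : m.+1%:R != 0 :> R by rewrite pnatr_eq0.
have E : limn (series (a m.+1)) = g m.+1 / m.+1%:R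
    + lam / m.+1%:R * limn (series (a m.+2)).
  apply: lim_seriesS => //.
    rewrite /a /= addn0 expr0 factS natrM.
    move: (f0 m) m0; move: (m`!%:R) (m.+1%:R) => x y x0 y0. by field; rewrite x0 y0.
  move=> i; rewrite /a /= !addSnnS exprS factS natrM.
  move: (f0 (m + i.+2)%N) m0; move: ((m + i.+2)`!%:R) (m.+1%:R) => x y x0 y0.
  by field; rewrite x0 y0.
rewrite !mulrN E opprK mulrDr -/mu -/(g _).
by move: (limn _) m0; move: (m.+1%:R) => y x y0; field.
Qed.

End stein.

(** * Independent copies of the weight *)

Section measurability.
Context {R : realType}.

Lemma measurable_invr : measurable_fun [set: R] (@GRing.inv R).
Proof.
have -> : [set: R] = [set x | x != 0] `|` [set 0].
  apply/seteqP; split=> // x _ /=.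
  by have [->|x0] := eqVneq x 0; [right|left].
have oN0 : open [set x : R | x != 0] by exact: open_neq.
apply/measurable_funU; [exact: open_measurable|exact: measurable_set1|split].
  apply: open_continuous_measurable_fun => // x /set_mem /= x0.
  exact: inv_continuous.
exact: measurable_fun_set1.
Qed.

Context d (T : measurableType d).

Lemma measurable_sum_cond (I : finType) (Q : pred I) (f : I -> T -> R) :
  (forall i, measurable_fun [set: T] (f i)) ->
  measurable_fun [set: T] (fun t => \sum_(i | Q i) f i t).
Proof.
move=> mf; rewrite (_ : (fun t => _) =
    fun t => \sum_(i <- [seq i <- index_enum I | Q i]) f i t).
  exact: measurable_sum.
by apply/funext => t; rewrite big_filter.
Qed.

Lemma measurable_prod_cond (I : finType) (Q : pred I) (f : I -> T -> R) :
  (forall i, measurable_fun [set: T] (f i)) ->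
  measurable_fun [set: T] (fun t => \prod_(i | Q i) f i t).
Proof.
move=> mf; rewrite (_ : (fun t => _) =
    fun t => \prod_(i <- [seq i <- index_enum I | Q i]) f i t).
  by apply: measurable_prod => i _.
by apply/funext => t; rewrite big_filter.
Qed.

Lemma measurable_edge_prob n (X : 'I_n -> T -> R) e :
  (forall i, measurable_fun [set: T] (X i)) ->
  measurable_fun [set: T] (fun t => edge_prob (X ^~ t) e).
Proof.
move=> mX; have mW : measurable_fun [set: T] (fun t => \prod_(v in e) X v t).
  exact: measurable_prod_cond.
apply: measurable_funM; first exact: mW.
apply: (measurableT_comp measurable_invr).
apply: measurable_funD => //.
exact: measurable_sum.
Qed.

Lemma measurable_graph_prob n (X : 'I_n -> T -> R) g :
  (forall i, measurable_fun [set: T] (X i)) ->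
  measurable_fun [set: T] (fun t => graph_prob (X ^~ t) g).
Proof.
move=> mX; apply: (measurable_prod_cond _ _ (fun e t =>
  if e \in g then edge_prob (X ^~ t) e else 1 - edge_prob (X ^~ t) e)) => e.
case: (e \in g); first exact: measurable_edge_prob.
apply: measurable_funB; first exact: measurable_cst.
exact: measurable_edge_prob.
Qed.

Lemma measurable_grg_cond_Eh n (X : 'I_n -> T -> R) k h :
  (forall i, measurable_fun [set: T] (X i)) ->
  measurable_fun [set: T] (fun t => grg_cond_Eh k (X ^~ t) h).
Proof.
move=> mX; apply: (measurable_sum_cond _ _ (fun g t =>
  h (num_cycles k g) * graph_prob (X ^~ t) g)) => g.
apply: measurable_funM; first exact: measurable_cst.
exact: measurable_graph_prob.
Qed.

End measurability.

Section iid.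
Context {R : realType} d (T : measurableType d) (P : probability T R).
Variables (W : {RV P >-> R}) (n : nat) (X : 'I_n -> {RV P >-> R}).
Hypothesis iidX : iid_copies W X.
Local Open Scope ereal_scope.

Lemma iid_ge0_integral i (g : R -> \bar R) : measurable_fun [set: R] g ->
  (forall y, 0 <= g y) -> \int[P]_t g (X i t) = \int[P]_t g (W t).
Proof.
move=> mg g0.
rewrite -[LHS](ge0_integral_distribution (X i) mg g0).
rewrite -[RHS](ge0_integral_distribution W mg g0).
apply: eq_measure_integral => A mA _; exact: (proj1 iidX).
Qed.

Lemma iid_pair i j (A B : set R) : i != j -> measurable A -> measurable B ->
  P (X i @^-1` A `&` X j @^-1` B) = P (X i @^-1` A) * P (X j @^-1` B).
Proof.
move=> ij mA mB.
pose C l := if l == i then A else if l == j then B else setT.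
have mC l : measurable (C l) by rewrite /C; case: ifP => // _; case: ifP.
have := (proj2 iidX) C mC; rewrite (bigD1 i) //= (bigD1 j) 1?eq_sym //=.
rewrite [X in _ * (_ * X)]big1; last first.
  move=> l /andP[li lj]; rewrite /C (negbTE li) (negbTE lj) preimage_setT.
  exact: probability_setT.
rewrite mule1 {2 3}/C eqxx eq_sym (negbTE ij) eqxx => <-; congr (P _).
apply/seteqP; split=> t.
  by move=> [tA tB] l _; rewrite /C; case: eqP => [->//|_]; case: eqP => [->//|_].
move=> tC; split.
  by have := tC i I; rewrite /C eqxx.
by have := tC j I; rewrite /C eq_sym (negbTE ij) eqxx.
Qed.

(** The law of the pair agrees with the product measure on rectangles, hence everywhere; Tonelli's
    theorem then separates the factors. *)
Lemma iid_ge0_integralM i j (f g : R -> R) : i != j ->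
  measurable_fun [set: R] f -> measurable_fun [set: R] g ->
  (forall y, 0 <= f y)%R -> (forall y, 0 <= g y)%R ->
  \int[P]_t (f (X i t) * g (X j t))%:E =
  \int[P]_t (f (W t))%:E * \int[P]_t (g (W t))%:E.
Proof.
move=> ij mf mg f0 g0.
have mphi : measurable_fun [set: T] (fun t => (X i t, X j t)).
  by apply: measurable_fun_pair.
pose phi : {RV P >-> (R * R)%type} := HB.pack (fun t => (X i t, X j t))
  (isMeasurableFun.Build _ _ _ _ _ mphi).
pose F (z : R * R) := (f z.1 * g z.2)%:E.
have mF : measurable_fun [set: R * R] F.
  apply/measurable_EFinP; apply: measurable_funM.
    exact: measurableT_comp mf _.
  exact: measurableT_comp mg _.
have F0 z : 0 <= F z by rewrite lee_fin mulr_ge0.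
rewrite -[LHS](ge0_integral_distribution phi mF F0).
have E : forall C, measurable C -> C `<=` setT -> distribution P phi C =
    (distribution P (X i) \x distribution P (X j)) C.
  move=> C mC _; apply/esym; apply: product_measure_unique => // A B mA mB.
  by rewrite -iid_pair.
rewrite (eq_measure_integral _ E) fubini_tonelli1 //.
rewrite /fubini_F /F /=.
transitivity (\int[distribution P (X i)]_x ((f x)%:E * \int[P]_t (g (W t))%:E)).
  apply: eq_integral => x _.
  under eq_integral do rewrite EFinM.
  rewrite ge0_integralZl_EFin //; last by apply/measurable_EFinP.
    rewrite (ge0_integral_distribution (X j) (f := EFin \o g)) //.
      rewrite (iid_ge0_integral _ (EFin \o g)) //.
      exact/measurable_EFinP.
    exact/measurable_EFinP.
  by move=> y _; rewrite lee_fin.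
rewrite ge0_integralZr //; first last.
- by apply: integral_ge0 => t _; rewrite lee_fin.
- by move=> x _; rewrite lee_fin.
- exact/measurable_EFinP.
congr (_ * _).
rewrite (ge0_integral_distribution (X i) (f := EFin \o f)) //.
  by rewrite (iid_ge0_integral _ (EFin \o f)) //; exact/measurable_EFinP.
exact/measurable_EFinP.
Qed.

Lemma iid_average_variance (g : R -> R) (m v : R) : (0 < n)%N ->
  measurable_fun [set: R] g -> (forall y, 0 <= g y)%R ->
  \int[P]_t (g (W t))%:E = m%:E -> \int[P]_t (g (W t) ^+ 2)%:E = v%:E ->
  \int[P]_t (((\sum_i g (X i t)) / n%:R - m) ^+ 2)%:E <= (v / n%:R)%:E.
Proof.
move=> n0 mg g0 gm gv.
have mgX i : measurable_fun [set: T] (fun t => g (X i t)).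
  exact: measurableT_comp mg _.
have mS : measurable_fun [set: T] (fun t => \sum_i g (X i t))%R.
  exact: measurable_sum.
have S0 t : (0 <= \sum_i g (X i t))%R by apply: sumr_ge0.
have m0 : (0 <= m)%R by rewrite -lee_fin -gm; apply: integral_ge0 => t _; rewrite lee_fin.
have nR : (n%:R != 0 :> R)%R by rewrite pnatr_eq0 -lt0n.
have E1 : \int[P]_t (\sum_i g (X i t))%:E = (n%:R * m)%:E.
  under eq_integral do rewrite -sumEFin.
  rewrite ge0_integral_sum //; last 2 first.
  - by move=> i; exact/measurable_EFinP.
  - by move=> i t _; rewrite lee_fin.
  rewrite (eq_bigr (fun=> m%:E)); first by rewrite sumEFin sumr_const card_ord mulr_natl.
  by move=> i _; rewrite (iid_ge0_integral _ (EFin \o g)) //; exact/measurable_EFinP.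
have E2 : \int[P]_t ((\sum_i g (X i t)) ^+ 2)%:E =
    (n%:R * v + n%:R * (n%:R - 1) * m ^+ 2)%:E.
  have -> : \int[P]_t ((\sum_i g (X i t)) ^+ 2)%:E =
      \int[P]_t \sum_i \sum_j (g (X i t) * g (X j t))%:E.
    apply: eq_integral => t _; rewrite expr2 mulr_suml -sumEFin.
    by apply: eq_bigr => i _; rewrite mulr_sumr -sumEFin.
  rewrite ge0_integral_sum //; last 2 first.
  - move=> i; apply: emeasurable_sum => j.
    by apply/measurable_EFinP; exact: measurable_funM.
  - by move=> i t _; apply: sume_ge0 => j _; rewrite lee_fin mulr_ge0.
  rewrite (eq_bigr (fun=> (v + (n%:R - 1) * m ^+ 2)%:E)).
    by rewrite sumEFin sumr_const card_ord -[X in X%:E = _]mulr_natl; congr (_%:E); ring.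
  move=> i _; rewrite ge0_integral_sum //; last 2 first.
  - by move=> j; apply/measurable_EFinP; exact: measurable_funM.
  - by move=> j t _; rewrite lee_fin mulr_ge0.
  rewrite (bigD1 i) //= EFinD; congr (_ + _).
    rewrite -gv -(iid_ge0_integral i (fun y => (g y ^+ 2)%:E)) //.
      by apply/measurable_EFinP; exact: measurable_funX.
    by move=> y; rewrite lee_fin sqr_ge0.
  rewrite (eq_bigr (fun=> (m ^+ 2)%:E)); last first.
    by move=> j ji; rewrite iid_ge0_integralM 1?eq_sym // gm -EFinM.
  rewrite sumEFin sumr_const cardC1 card_ord -[X in X%:E = _]mulr_natl.
  by congr (_%:E); congr (_ * _)%R; rewrite -subn1 natrB.
have mQ : measurable_fun [set: T] (fun t => (((\sum_i g (X i t)) / n%:R - m) ^+ 2)%R).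
  by apply: measurable_funX; apply: measurable_funB => //; apply: measurable_funM.
(* The cross term of the square is moved to the left, so that all integrands are nonnegative and
   additivity holds before finiteness of the left integral is known. *)
have E3 : \int[P]_t (((\sum_i g (X i t)) / n%:R - m) ^+ 2)%:E +
    (2 * m / n%:R)%:E * (n%:R * m)%:E =
    (n%:R ^- 2)%:E * (n%:R * v + n%:R * (n%:R - 1) * m ^+ 2)%:E + (m ^+ 2)%:E.
  have c0 : (0 <= 2 * m / n%:R)%R by rewrite divr_ge0 ?mulr_ge0.
  have mS2 : measurable_fun [set: T] (fun t => (\sum_i g (X i t)) ^+ 2)%R.
    exact: measurable_funX.
  have S2 t : (0 <= (\sum_i g (X i t)) ^+ 2)%R by exact: sqr_ge0.
  have n2 : (0 <= n%:R ^- 2 :> R)%R by rewrite invr_ge0 exprn_ge0.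
  rewrite -E1 -E2 -!ge0_integralZl_EFin //; try by exact/measurable_EFinP.
  rewrite -ge0_integralD //; try by exact/measurable_EFinP.
  - rewrite -[in RHS](_ : \int[P]_t (m ^+ 2)%:E = (m ^+ 2)%:E); last first.
      rewrite integral_cst // [X in _ * X](_ : _ = 1) ?mule1 //; exact: probability_setT.
    rewrite -ge0_integralD //.
    + apply: eq_integral => t _; rewrite -!EFinM -!EFinD; congr (_%:E).
      by move: (\sum_i _)%R => s; field.
    + by move=> t _; rewrite -EFinM lee_fin mulr_ge0.
    + by apply: emeasurable_funM => //; exact/measurable_EFinP.
    + by move=> t _; rewrite lee_fin sqr_ge0.
  - by move=> t _; rewrite lee_fin sqr_ge0.
  - by move=> t _; rewrite -EFinM lee_fin mulr_ge0.
  - by apply: emeasurable_funM => //; exact/measurable_EFinP.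
  - by move=> t _; rewrite lee_fin.
  - by move=> t _; rewrite lee_fin.
move: E3; set I := \int[P]_t _; have I0 : 0 <= I.
  by apply: integral_ge0 => t _; rewrite lee_fin sqr_ge0.
clearbody I; rewrite -!EFinM -!EFinD.
case: I I0 => [r _|_|]; [|by rewrite addye|by rewrite leeNy_eq].
rewrite -!EFinD => -[E3]; rewrite lee_fin.
have -> : (r = v / n%:R - m ^+ 2 / n%:R)%R.
  apply: (addIr (2 * m / n%:R * (n%:R * m))%R); rewrite E3; by field.
by rewrite lerBlDr lerDl divr_ge0 ?sqr_ge0.
Qed.

End iid.

(** * Moments of the weight *)

Section moments.
Context {R : realType} d (T : measurableType d) (P : probability T R).
Variables (W : {RV P >-> R}).
(** The weight is positive only almost surely. Its positive part agrees with it almost surely and is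
    nonnegative everywhere, as the integral lemmas require. *)
Local Notation pos y := (Num.max y 0).

Lemma ae_probability1 (A : set T) : measurable A -> P A = 1%E ->
  \forall t \ae P, A t.
Proof.
move=> mA PA; exists (~` A); split => //; first exact: measurableC.
by rewrite probability_setC // PA subee.
Qed.

Lemma tail_eventually_le1 (f : R -> R) j :
  (f x * x ^+ j) @[x --> +oo%R] --> (0 : R) ->
  exists2 x0, 1 <= x0 & forall x, x0 <= x -> f x * x ^+ j <= 1.
Proof.
move=> /cvgrPdist_lt /(_ 1 ltr01) [M [_ HM]].
exists (Num.max 1 (M + 1)); first by rewrite le_max lexx.
move=> x; rewrite ge_max => /andP[x1 xM].
have := HM x; rewrite sub0r normrN => /(_ _) H.
apply: le_trans (ler_norm _) _; apply: ltW; apply: H; lra.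
Qed.

Lemma pos_measurable : measurable_fun [set: R] (fun y : R => pos y).
Proof. exact: measurable_maxr. Qed.

Lemma pos_ge0 (y : R) : 0 <= pos y.
Proof. by rewrite le_max lexx orbT. Qed.

(** Dyadic levels [a j = 2^j x0] with [1 <= x0]: between [a j] and [a (j+1)] one has
    [1 + W <= 4 a j], while [P(W > a j) <= (a j)^-7] because [7 <= 2k + 1]. Level [j] thus
    contributes at most [4^6 / a j <= 4^6 / 2^j], and the series is geometric. *)
Lemma sixth_moment_lty k : (3 <= k)%N ->
  (fine (P [set t | x < W t]) * x ^+ (2 * k + 1)) @[x --> +oo%R] --> (0 : R) ->
  (\int[P]_t ((1 + pos (W t)) ^+ 6)%:E < +oo)%E.
Proof.
move=> k3 /tail_eventually_le1 [x0 x0_ge1 tail].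
have k7 : (7 <= 2 * k + 1)%N by move: k3; clear; lia.
have [N N0 NE] : exists2 N : R, 0 <= N & N = 4 ^+ 6 by exists (4 ^+ 6); rewrite ?exprn_ge0.
have x0_ge0 : 0 <= x0 by lra.
pose a j : R := 2 ^+ j * x0.
have a_ge1 j : 1 <= a j.
  by apply: mulr_ege1 => //; apply: exprn_ege1; rewrite ler1n.
have a_gt0 j : 0 < a j by apply: lt_le_trans (a_ge1 j).
have a_ge0 j : 0 <= a j by exact: ltW.
pose A j := [set t | a j < W t].
have mA j : measurable (A j).
  rewrite (_ : A j = W @^-1` `]a j, +oo[%classic); last first.
    by apply/seteqP; split=> t /=; rewrite in_itv /= andbT.
  exact: measurable_funPTI.
pose u j t : \bar R := ((4 * a j) ^+ 6 * \1_(A j) t)%:E.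
have u0 j t : (0 <= u j t)%E by rewrite lee_fin mulr_ge0 ?exprn_ge0 // mulr_ge0.
have mu j : measurable_fun [set: T] (u j).
  apply/measurable_EFinP; apply: measurable_funM; first exact: measurable_cst.
  exact: measurable_indic.
have pw t : (((1 + pos (W t)) ^+ 6)%:E <=
    ((1 + x0) ^+ 6)%:E + \sum_(0 <= j <oo) u j t)%E.
  have S0 : (0 <= \sum_(0 <= j <oo) u j t)%E by apply: nneseries_ge0.
  have [Wx|xW] := leP (W t) x0.
    apply: (@le_trans _ _ ((1 + x0) ^+ 6)%:E); last by rewrite leeDl.
    rewrite lee_fin lerXn2r ?nnegrE ?addr_ge0 ?pos_ge0 //.
    by rewrite lerD2l ge_max Wx /=; lra.
  have ex : exists j, W t <= a j.
    exists (Num.bound (W t)); apply: (@le_trans _ _ (2 ^+ Num.bound (W t))).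
      by rewrite ltW // upper_nthrootP.
    by rewrite ler_peMr // exprn_ge0.
  have [[|j] jW jmin] := ex_minnP ex.
    by move: jW; rewrite /a expr0 mul1r leNgt xW.
  have Wj : a j < W t.
    by rewrite ltNge; apply/negP => /jmin; rewrite ltnn.
  apply: le_trans (_ : ((4 * a j) ^+ 6)%:E <= _)%E.
    rewrite lee_fin lerXn2r ?nnegrE ?addr_ge0 ?pos_ge0 ?mulr_ge0 //.
    have -> : pos (W t) = W t by rewrite max_l // ltW // (lt_trans _ Wj).
    move: jW; rewrite /a exprS -mulrA -/(a j); have := a_ge1 j; lra.
  rewrite -[leLHS]add0e; apply: leeD; first by rewrite lee_fin exprn_ge0; lra.
  apply: le_trans (nneseries_lim_ge j.+1 (fun i _ _ => u0 i t)).
  rewrite big_nat_recr //= -[leLHS]add0e; apply: leeD.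
    by apply: sume_ge0 => i _; exact: u0.
  by rewrite /u indicE mem_set // mulr1.
have mpos6 : measurable_fun [set: T] (fun t => (1 + pos (W t)) ^+ 6).
  apply: measurable_funX; apply: measurable_funD => //.
  exact: measurableT_comp pos_measurable _.
apply: (@le_lt_trans _ _ (((1 + x0) ^+ 6)%:E + (2 * N)%:E)%E); last first.
  by rewrite -EFinD ltry.
apply: (@le_trans _ _ (\int[P]_t (((1 + x0) ^+ 6)%:E + \sum_(0 <= j <oo) u j t))%E).
  apply: ge0_le_integral => //.
  - by move=> t _; rewrite lee_fin exprn_ge0 // addr_ge0 ?pos_ge0.
  - exact/measurable_EFinP.
  - apply: emeasurable_funD; first exact: measurable_cst.
    by apply: ge0_emeasurable_sum => // j t _ _; exact: u0.
rewrite ge0_integralD //; first last.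
- by apply: ge0_emeasurable_sum => // j t _ _; exact: u0.
- by move=> t _; apply: nneseries_ge0.
- by move=> t _; rewrite lee_fin exprn_ge0; lra.
apply: leeD.
  rewrite integral_cst // [X in (_ * X)%E](_ : _ = 1%E) ?mule1 //.
  exact: probability_setT.
rewrite integral_nneseries //.
have geo := @cvg_geometric_eseries_half R (2 * N) 0.
rewrite expr0 divr1 in geo; rewrite -(cvg_lim _ geo) //.
apply: lee_nneseries => [j _ _|j _]; first by apply: integral_ge0 => t _; exact: u0.
rewrite /u; under eq_integral do rewrite EFinM.
rewrite ge0_integralZl_EFin ?exprn_ge0 ?mulr_ge0 //; last first.
  by apply/measurable_EFinP; exact: measurable_indic.
have fP : P (A j) \is a fin_num by exact: fin_num_measure.
rewrite [X in (_ * X)%E](_ : _ = (fine (P (A j)))%:E); last first.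
  by rewrite integral_indic // setIT; apply/esym; exact: fineK fP.
rewrite -EFinM lee_fin.
have aj0 : x0 <= a j by rewrite /a ler_peMl ?exprn_ege1 ?ler1n //; lra.
have := tail (a j) aj0; rewrite -/(A j) => t1.
have p0 : 0 <= fine (P (A j)) by exact: fine_ge0.
have t7 : fine (P (A j)) * a j ^+ 7 <= 1.
  apply: le_trans t1; apply: ler_wpM2l p0 _ _ _; apply: ler_weXn2l (a_ge1 j) _ _ _.
  exact: k7.
have -> : 2 * N / (2 ^ (j + 1))%:R = N / 2 ^+ j.
  rewrite natrX exprD expr1; field.
  by rewrite expf_neq0 // pnatr_eq0.
rewrite ler_pdivlMr ?exprn_gt0 //.
apply: (@le_trans _ _ (N * (fine (P (A j)) * a j ^+ 7))); last by rewrite ler_piMr.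
rewrite exprMn -NE [a j ^+ 7]exprS.
have aj2 : 2 ^+ j <= a j by rewrite ler_peMr // exprn_ge0.
have X0 : 0 <= fine (P (A j)) * a j ^+ 6 by rewrite mulr_ge0 ?exprn_ge0.
have -> : N * a j ^+ 6 * fine (P (A j)) * 2 ^+ j =
  N * (2 ^+ j * (fine (P (A j)) * a j ^+ 6)) by ring.
by apply: ler_wpM2l => //; rewrite [leRHS]mulrCA ler_wpM2r.
Qed.

Hypothesis moment6 : (\int[P]_t ((1 + pos (W t)) ^+ 6)%:E < +oo)%E.

Lemma moment_fin (g : R -> R) : measurable_fun [set: R] g ->
  (forall y, 0 <= g y <= (1 + pos y) ^+ 6) ->
  exists v : R, (\int[P]_t (g (W t))%:E = v%:E)%E.
Proof.
move=> mg g6.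
have I0 : (0 <= \int[P]_t (g (W t))%:E)%E.
  by apply: integral_ge0 => t _; rewrite lee_fin; case/andP: (g6 (W t)).
exists (fine (\int[P]_t (g (W t))%:E)%E); rewrite fineK // ge0_fin_numE //.
apply: le_lt_trans moment6; apply: ge0_le_integral => //.
- by move=> t _; rewrite lee_fin; case/andP: (g6 (W t)).
- by apply/measurable_EFinP; exact: measurableT_comp mg _.
- apply/measurable_EFinP; apply: measurable_funX; apply: measurable_funD => //.
  exact: measurableT_comp pos_measurable _.
- by move=> t _; rewrite lee_fin; case/andP: (g6 (W t)).
Qed.

Lemma ae_pos : P [set t | 0 < W t] = 1%E -> \forall t \ae P, 0 < W t.
Proof.
move=> W1; apply: (ae_probability1 [set t | 0 < W t]) => //.
rewrite (_ : [set t | _] = W @^-1` `]0, +oo[%classic); last first.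
  by apply/seteqP; split=> t /=; rewrite in_itv /= andbT.
exact: measurable_funPTI.
Qed.

Lemma integral_pos (g : R -> R) : P [set t | 0 < W t] = 1%E ->
  measurable_fun [set: R] g ->
  (\int[P]_t (g (W t))%:E = \int[P]_t (g (pos (W t)))%:E)%E.
Proof.
move=> W1 mg; apply: ae_eq_integral => //.
- by apply/measurable_EFinP; exact: measurableT_comp mg _.
- apply/measurable_EFinP; apply: (measurableT_comp mg).
  exact: measurableT_comp pos_measurable _.
- apply: filterS (ae_pos W1) => t W0 _; rewrite max_l //; exact: ltW.
Qed.

(** A zero integral would force [g (W t) = 0] almost everywhere, against [W > 0]. It allows division
    by the mean and gives a positive Poisson parameter. *)
Lemma integral_gt0 (g : R -> R) (v : R) : P [set t | 0 < W t] = 1%E ->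
  measurable_fun [set: R] g -> (forall y, 0 <= g y) ->
  (forall y, 0 < y -> 0 < g y) ->
  (\int[P]_t (g (W t))%:E = v%:E)%E -> 0 < v.
Proof.
move=> W1 mg g0 g_gt0 Ev; have v0 : 0 <= v.
  by rewrite -lee_fin -Ev; apply: integral_ge0 => t _; rewrite lee_fin.
rewrite lt_neqAle v0 andbT; apply/eqP => v_eq0; move: Ev; rewrite -v_eq0.
have -> : (\int[P]_t (g (W t))%:E = \int[P]_t `|(g (W t))%:E|)%E.
  by apply: eq_integral => t _; rewrite abse_EFin ger0_norm.
move=> Ev; have mgW : measurable_fun [set: T] (fun t => (g (W t))%:E).
  by apply/measurable_EFinP; exact: measurableT_comp mg _.
have ae0 := proj1 (ae_eq_integral_abs P measurableT mgW) Ev.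
have PT : (0 < P [set: T])%E.
  by rewrite [X in (_ < X)%E](_ : _ = 1%E) //; exact: probability_setT.
have pf := ae_properfilter_algebraOfSetsType PT.
have [t [/g_gt0 gt /(_ I) [g_0]]] := filter_ex (filterI (ae_pos W1) ae0).
by rewrite g_0 ltxx in gt.
Qed.

End moments.

(** * Averaging over the weights *)

Section bounded_integrals.
Context {R : realType} d (T : measurableType d) (P : probability T R).
Local Open Scope ereal_scope.

Lemma le_ge0_integralD (f g : T -> R) (x y : R) :
  measurable_fun [set: T] f -> measurable_fun [set: T] g ->
  (forall t, 0 <= f t)%R -> (forall t, 0 <= g t)%R ->
  \int[P]_t (f t)%:E <= x%:E -> \int[P]_t (g t)%:E <= y%:E ->
  \int[P]_t (f t + g t)%:E <= (x + y)%:E.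
Proof.
move=> mf mg f0 g0 fx gy; under eq_integral do rewrite EFinD.
rewrite ge0_integralD //; try by exact/measurable_EFinP.
- by rewrite EFinD leeD.
- by move=> t _; rewrite lee_fin.
- by move=> t _; rewrite lee_fin.
Qed.

Lemma le_ge0_integralZ (c : R) (f : T -> R) (x : R) : (0 <= c)%R ->
  measurable_fun [set: T] f -> (forall t, 0 <= f t)%R ->
  \int[P]_t (f t)%:E <= x%:E -> \int[P]_t (c * f t)%:E <= (c * x)%:E.
Proof.
move=> c0 mf f0 fx; under eq_integral do rewrite EFinM.
rewrite ge0_integralZl_EFin //; last by exact/measurable_EFinP.
  by rewrite EFinM lee_wpmul2l // lee_fin.
by move=> t _; rewrite lee_fin.
Qed.

Lemma integral_probability_cst (c : R) : \int[P]_t c%:E = c%:E.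
Proof.
rewrite integral_cst // [X in _ * X](_ : _ = 1) ?mule1 //.
exact: probability_setT.
Qed.

(* [F] is only almost surely bounded, so integrability is part of the claim. *)
Lemma abse_integral_sub_le (F Z : T -> R) (mu z : R) :
  measurable_fun [set: T] F -> measurable_fun [set: T] Z ->
  (forall t, 0 <= Z t)%R ->
  (\forall t \ae P, `|F t| <= 1)%R -> (\forall t \ae P, `|F t - mu| <= Z t)%R ->
  \int[P]_t (Z t)%:E <= z%:E ->
  `| \int[P]_t (F t)%:E - mu%:E | <= z%:E.
Proof.
move=> mF mZ Z0 F1 FZ Zz.
have iF : P.-integrable [set: T] (EFin \o F).
  apply/integrableP; split; first exact/measurable_EFinP.
  apply: (@le_lt_trans _ _ (\int[P]_t 1%:E)); last by rewrite integral_probability_cst ltry.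
  apply: ae_ge0_le_integral => //.
  - by apply: measurableT_comp => //; exact/measurable_EFinP.
  - by apply: filterS F1 => t Ft _; rewrite /= lee_fin.
have imu : P.-integrable [set: T] (EFin \o cst mu).
  exact: finite_measure_integrable_cst.
rewrite -(integral_probability_cst mu) -(integralB_EFin measurableT iF imu).
have mB : measurable_fun [set: T] (fun t => (F t)%:E - mu%:E).
  by apply: emeasurable_funB => //; exact/measurable_EFinP.
apply: le_trans (le_abse_integral _ _ _) _ => //.
apply: le_trans Zz; apply: ae_ge0_le_integral => //.
- exact: measurableT_comp.
- by move=> t _; rewrite lee_fin.
- exact/measurable_EFinP.
- by apply: filterS FZ => t Ft _; rewrite -EFinB lee_fin.
Qed.

End bounded_integrals.

Section expectation_bound.
Context {R : realType} d (T : measurableType d) (P : probability T R).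
Variables (W : {RV P >-> R}) (n m : nat) (X : 'I_n -> {RV P >-> R}).
Local Notation pos y := (Num.max y 0).
Local Notation k := m.+3.
Hypothesis iidX : iid_copies W X.
Hypothesis W1 : P [set t | 0 < W t] = 1%E.
Variables (m1 m2 m3 v4 c6 c : R).
Hypothesis m1E : (\int[P]_t (pos (W t))%:E = m1%:E)%E.
Hypothesis m2E : (\int[P]_t (pos (W t) ^+ 2)%:E = m2%:E)%E.
Hypothesis m3E : (\int[P]_t (weight4 (pos (W t)))%:E = m3%:E)%E.
Hypothesis v4E : (\int[P]_t ((pos (W t) ^+ 2) ^+ 2)%:E = v4%:E)%E.
Hypothesis c6E : (\int[P]_t (pos (W t) ^+ 6)%:E = c6%:E)%E.
Hypothesis cE : (\int[P]_t ((1 + pos (W t)) ^+ 6)%:E = c%:E)%E.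
Variables (B mu : R) (f h : nat -> R).
Let lam : R := (m2 / m1) ^+ k / (2 * k)%:R.
Hypothesis fB : forall j, `|f j| <= B.
Hypothesis fh : forall j, lam * f j.+1 - j%:R * f j = h j - mu.
Hypotheses (h1 : forall j, `|h j| <= 1) (mu1 : `|mu| <= 1).
Hypotheses (n_gt0 : (0 < n)%N) (n_large : 2 <= m1 * n%:R).

Let s : R := Num.sqrt n%:R.
Let tau : R := Num.sqrt s.

Let n_ge1 : 1 <= n%:R :> R. Proof. by rewrite ler1n. Qed.
Let s_ge1 : 1 <= s. Proof. by rewrite -[leLHS]sqrtr1 ler_wsqrtr. Qed.
Let s_gt0 : 0 < s. Proof. exact: lt_le_trans s_ge1. Qed.
Let s2 : s ^+ 2 = n%:R. Proof. by rewrite sqr_sqrtr. Qed.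
Let tau_ge1 : 1 <= tau. Proof. by rewrite -[leLHS]sqrtr1 ler_wsqrtr. Qed.
Let tau_ge0 : 0 <= tau. Proof. exact: le_trans tau_ge1. Qed.
Let tau2 : tau ^+ 2 = s. Proof. by rewrite sqr_sqrtr // ltW. Qed.

Let mpos : measurable_fun [set: R] (fun y : R => pos y) := pos_measurable.
Let pos0 (y : R) : 0 <= pos y := pos_ge0 y.

Let wt (y : R) : R := weight4 (pos y) * (y <= tau)%R%:R.

Let mweight : measurable_fun [set: R] (fun y : R => weight4 (pos y)).
Proof.
apply: measurable_funM; apply: measurable_funX => //.
exact: measurable_funD.
Qed.

Let weight_ge0 (y : R) : 0 <= weight4 (pos y).
Proof. by rewrite mulr_ge0 // exprn_ge0 // addr_ge0. Qed.

Let mwt : measurable_fun [set: R] wt.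
Proof.
apply: measurable_funM; first exact: mweight.
rewrite (_ : (fun y : R => _) = \1_(`]-oo, tau]%classic)).
  by apply: measurable_indic; exact: measurable_itv.
by apply/funext => y; rewrite indicE mem_setE in_itv.
Qed.

Let wt_ge0 y : 0 <= wt y. Proof. by rewrite mulr_ge0. Qed.

Let wt_le y : wt y <= weight4 (pos y).
Proof. by rewrite /wt; case: (y <= tau); rewrite ?mulr1 ?mulr0. Qed.

(** Of the eight powers of [1 + pos y], two are spent on the truncation:
    [(1 + tau)^2 <= 4 tau^2 = 4 s], as [1 <= tau]. *)
Let wt2_le y : wt y ^+ 2 <= 4 * s * (1 + pos y) ^+ 6.
Proof.
have p6 : 0 <= (1 + pos y) ^+ 6 by rewrite exprn_ge0 // addr_ge0.
have s4 : 0 <= 4 * s by rewrite mulr_ge0 // ltW.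
rewrite /wt; case: (leP y tau) => yt; last by rewrite mulr0 expr0n /= mulr_ge0.
rewrite /= mulr1 /weight4.
have pt : pos y <= tau by rewrite ge_max yt.
have p1 := pos0 y.
apply: (@le_trans _ _ ((1 + pos y) ^+ 2 * (1 + pos y) ^+ 6)).
  rewrite -exprD exprMn -!exprM (_ : (1 + pos y) ^+ (2 + 6) = (1 + pos y) ^+ 4 * (1 + pos y) ^+ 4).
    by rewrite ler_wpM2r ?exprn_ge0 ?addr_ge0 // lerXn2r ?nnegrE ?addr_ge0 // lerDr.
  by rewrite -exprD.
rewrite ler_wpM2r // -tau2; have := tau_ge1; nra.
Qed.

(** The truncated mean varies with [n] but stays below [m3], so the threshold [M = m3 + 1] exceeds
    it by at least 1 for every [n]. *)
Let wt_mean : exists2 mt : R, (\int[P]_t (wt (W t))%:E = mt%:E)%E & mt <= m3.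
Proof.
have H : (\int[P]_t (wt (W t))%:E <= m3%:E)%E.
  rewrite -m3E; apply: ge0_le_integral => //.
  - by move=> t _; rewrite lee_fin.
  - by apply/measurable_EFinP; exact: measurableT_comp mwt _.
  - by apply/measurable_EFinP; exact: (measurableT_comp mweight).
  - by move=> t _; rewrite lee_fin.
have I0 : (0 <= \int[P]_t (wt (W t))%:E)%E.
  by apply: integral_ge0 => t _; rewrite lee_fin.
exists (fine (\int[P]_t (wt (W t))%:E)%E).
  by rewrite fineK // ge0_fin_numE // (le_lt_trans H) ?ltry.
by rewrite -lee_fin fineK // ge0_fin_numE // (le_lt_trans H) ?ltry.
Qed.

Let wt_var : exists2 v : R, (\int[P]_t (wt (W t) ^+ 2)%:E = v%:E)%E & v <= 4 * s * c.
Proof.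
have mwt2 : measurable_fun [set: T] (fun t => wt (W t) ^+ 2).
  by apply: measurable_funX; exact: measurableT_comp mwt _.
have mp6 : measurable_fun [set: T] (fun t => (1 + pos (W t)) ^+ 6).
  apply: measurable_funX; apply: measurable_funD => //.
  exact: measurableT_comp mpos _.
have H : (\int[P]_t (wt (W t) ^+ 2)%:E <= (4 * s * c)%:E)%E.
  apply: (@le_trans _ _ (\int[P]_t (4 * s * (1 + pos (W t)) ^+ 6)%:E)%E).
    apply: ge0_le_integral => //.
    - by move=> t _; rewrite lee_fin sqr_ge0.
    - exact/measurable_EFinP.
    - by apply/measurable_EFinP; apply: measurable_funM.
    - by move=> t _; rewrite lee_fin.
  apply: le_ge0_integralZ => //; first by rewrite mulr_ge0 // ltW.
    by move=> t; rewrite exprn_ge0 // addr_ge0.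
  by rewrite cE.
have I0 : (0 <= \int[P]_t (wt (W t) ^+ 2)%:E)%E.
  by apply: integral_ge0 => t _; rewrite lee_fin sqr_ge0.
exists (fine (\int[P]_t (wt (W t) ^+ 2)%:E)%E).
  by rewrite fineK // ge0_fin_numE // (le_lt_trans H) ?ltry.
by rewrite -lee_fin fineK // ge0_fin_numE // (le_lt_trans H) ?ltry.
Qed.

Let ae_X : \forall t \ae P, forall i, 0 < X i t.
Proof.
apply: filter_forall => i; apply: ae_pos.
have E (Y : {RV P >-> R}) : [set t | 0 < Y t] = Y @^-1` `]0, +oo[%classic.
  by apply/seteqP; split=> t /=; rewrite in_itv /= andbT.
by rewrite E (proj1 iidX) -?E.
Qed.

(** The summands [m2], [v4], [4 * c], [c6] and [1] bound, after division by [s], the integrals of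
    the five terms of [pointwise_bound]: the two rescaled squared deviations, the truncated one, the
    sixth powers, and [s^-1]. *)
Lemma expectation_bound :
  (`| \int[P]_t (grg_cond_Eh k (fun i => X i t) h)%:E - mu%:E | <=
  (pointwise_const m m1 m2 (m3 + 1) B * (m2 + v4 + 4 * c + c6 + 1) / s)%:E)%E.
Proof.
have [mt mtE mt_le] := wt_mean; have [v vE v_le] := wt_var.
have m1_gt0 : 0 < m1.
  by apply: (integral_gt0 d T P W (fun y => Num.max y 0)) m1E => // y y0; rewrite lt_max y0.
have m2_ge0 : 0 <= m2.
  by rewrite -lee_fin -m2E; apply: integral_ge0 => t _; rewrite lee_fin sqr_ge0.
have mpos2 : measurable_fun [set: R] (fun y : R => pos y ^+ 2) by exact: measurable_funX.
have mpos6 : measurable_fun [set: R] (fun y : R => pos y ^+ 6) by exact: measurable_funX.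
have m23 : m2 <= m3.
  rewrite -lee_fin -m2E -m3E; apply: ge0_le_integral => //.
  - by move=> t _; rewrite lee_fin sqr_ge0.
  - by apply/measurable_EFinP; exact: (measurableT_comp mpos2).
  - by apply/measurable_EFinP; exact: (measurableT_comp mweight).
  - move=> t _; rewrite lee_fin /weight4 ler_peMr ?sqr_ge0 //.
    by have := pos0 (W t); nra.
have m2M : m2 <= m3 + 1 by lra.
set K := pointwise_const _ _ _ _ _.
have K0 : 0 <= K.
  have := good_const_ge0 m m1 m2 (m3 + 1) B f m1_gt0 m2_ge0 m2M fB.
  have := slope_const_ge0 m m1 m2 (m3 + 1) B f m1_gt0 m2_ge0 m2M fB.
  have : 0 <= 8 / m1 ^+ 2 by rewrite divr_ge0 // sqr_ge0.
  by rewrite /K /pointwise_const; lra.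
have sn : s * (n%:R)^-1 = s^-1.
  by rewrite -s2; field; rewrite gt_eqF.
pose z1 t := s * ((\sum_i pos (X i t)) / n%:R - m1) ^+ 2.
pose z2 t := s * ((\sum_i pos (X i t) ^+ 2) / n%:R - m2) ^+ 2.
pose z3 t := ((\sum_i wt (X i t)) / n%:R - mt) ^+ 2.
pose z4 t := (n%:R * s)^-1 * \sum_i pos (X i t) ^+ 6.
pose Z t := z1 t + z2 t + z3 t + z4 t + s^-1.
have mavg (g : R -> R) (b : R) : measurable_fun [set: R] g ->
    measurable_fun [set: T] (fun t => ((\sum_i g (X i t)) / n%:R - b) ^+ 2).
  move=> mg; apply: measurable_funX; apply: measurable_funB => //.
  apply: measurable_funM => //; apply: measurable_sum => i.
  exact: measurableT_comp mg _.
have mz1 : measurable_fun [set: T] z1.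
  by apply: measurable_funM => //; exact: (mavg (fun y => pos y)).
have mz2 : measurable_fun [set: T] z2.
  by apply: measurable_funM => //; exact: (mavg (fun y => pos y ^+ 2)).
have mz3 : measurable_fun [set: T] z3 by exact: mavg.
have mS6 : measurable_fun [set: T] (fun t => \sum_i pos (X i t) ^+ 6).
  by apply: measurable_sum => i; exact: (measurableT_comp mpos6).
have mz4 : measurable_fun [set: T] z4 by exact: measurable_funM.
have S6_0 t : 0 <= \sum_i pos (X i t) ^+ 6.
  by apply: sumr_ge0 => i _; rewrite exprn_ge0.
have z1_0 t : 0 <= z1 t by rewrite mulr_ge0 ?sqr_ge0 // ltW.
have z2_0 t : 0 <= z2 t by rewrite mulr_ge0 ?sqr_ge0 // ltW.
have z3_0 t : 0 <= z3 t by rewrite sqr_ge0.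
have ns0 : 0 <= (n%:R * s)^-1 by rewrite invr_ge0 mulr_ge0 // ltW.
have z4_0 t : 0 <= z4 t by rewrite mulr_ge0.
have si0 : 0 <= s^-1 by rewrite invr_ge0 ltW.
have I1 : (\int[P]_t (z1 t)%:E <= (m2 / s)%:E)%E.
  have -> : m2 / s = s * (m2 / n%:R) by rewrite mulrCA sn.
  apply: le_ge0_integralZ; [exact: ltW|exact: (mavg (fun y => pos y))|..].
    by move=> t; rewrite sqr_ge0.
  exact: (iid_average_variance d T P W n X iidX (fun y => pos y) m1 m2
    n_gt0 mpos pos0 m1E m2E).
have I2 : (\int[P]_t (z2 t)%:E <= (v4 / s)%:E)%E.
  have -> : v4 / s = s * (v4 / n%:R) by rewrite mulrCA sn.
  apply: le_ge0_integralZ; [exact: ltW|exact: (mavg (fun y => pos y ^+ 2))|..].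
    by move=> t; rewrite sqr_ge0.
  apply: (iid_average_variance d T P W n X iidX (fun y => pos y ^+ 2) m2 v4
    n_gt0 mpos2 _ m2E v4E).
  by move=> y; rewrite sqr_ge0.
have I3 : (\int[P]_t (z3 t)%:E <= (4 * c / s)%:E)%E.
  apply: le_trans (iid_average_variance d T P W n X iidX wt mt v n_gt0 mwt wt_ge0 mtE vE) _.
  have -> : 4 * c / s = (4 * s * c) / n%:R by rewrite -sn; ring.
  by rewrite lee_fin ler_wpM2r // invr_ge0.
have I4 : (\int[P]_t (z4 t)%:E <= (c6 / s)%:E)%E.
  have -> : c6 / s = (n%:R * s)^-1 * (n%:R * c6).
    by field; rewrite gt_eqF //= pnatr_eq0 -lt0n.
  apply: le_ge0_integralZ => //.
  under eq_integral do rewrite -sumEFin.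
  rewrite ge0_integral_sum //; last 2 first.
  - by move=> i; apply/measurable_EFinP; exact: (measurableT_comp mpos6).
  - by move=> i t _; rewrite lee_fin exprn_ge0.
  rewrite (eq_bigr (fun=> c6%:E)); first by rewrite sumEFin sumr_const card_ord mulr_natl.
  move=> i _; rewrite -c6E.
  apply: (iid_ge0_integral d T P W n X iidX i (fun y => (pos y ^+ 6)%:E)).
    exact/measurable_EFinP.
  by move=> y; rewrite lee_fin exprn_ge0.
have I5 : (\int[P]_t (s^-1)%:E <= (1 / s)%:E)%E.
  by rewrite integral_probability_cst mul1r.
have IZ : (\int[P]_t (Z t)%:E <= ((m2 + v4 + 4 * c + c6 + 1) / s)%:E)%E.
  rewrite (_ : _ / s = m2 / s + v4 / s + 4 * c / s + c6 / s + 1 / s); last by ring.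
  have m12 : measurable_fun [set: T] (fun t => z1 t + z2 t) by exact: measurable_funD.
  have m123 : measurable_fun [set: T] (fun t => z1 t + z2 t + z3 t) by exact: measurable_funD.
  have m1234 : measurable_fun [set: T] (fun t => z1 t + z2 t + z3 t + z4 t).
    exact: measurable_funD.
  apply: le_ge0_integralD => //; first by move=> t; rewrite !addr_ge0.
  apply: le_ge0_integralD => //; first by move=> t; rewrite !addr_ge0.
  apply: le_ge0_integralD => //; first by move=> t; rewrite !addr_ge0.
  exact: le_ge0_integralD.
have mZ : measurable_fun [set: T] Z by do 4! apply: measurable_funD => //.
have Z0 t : 0 <= Z t by rewrite !addr_ge0.
apply: (abse_integral_sub_le d T P (fun t => grg_cond_Eh k (fun i => X i t) h)
  (fun t => K * Z t)).
- exact: (measurable_grg_cond_Eh d T n (fun i t => X i t)).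
- exact: measurable_funM.
- by move=> t; rewrite mulr_ge0.
- apply: filterS ae_X => t Xt.
  exact: (grg_cond_Eh_le1 m n (fun i => X i t) Xt h h1).
- apply: filterS ae_X => t Xt.
  have posX i : pos (X i t) = X i t by rewrite max_l // ltW.
  have := pointwise_bound m n (fun i => X i t) Xt m1 m2 (m3 + 1) B mu f h
    m1_gt0 m2_ge0 m2M fB fh tau s mt n_gt0 n_large tau_ge0 s_gt0 s2.
  have t6 : tau ^+ 6 = n%:R * s by rewrite -s2 -exprSr -tau2 -exprM.
  have mtm : mt <= m3 + 1 - 1 by lra.
  move=> /(_ t6 s_ge1 mtm h1 mu1) /le_trans; apply.
  rewrite -/K ler_wpM2l // /Z /z1 /z2 /z3 /z4 /wt.
  rewrite le_eqVlt; apply/orP; left; apply/eqP.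
  congr (_ + _ + _ + _ + _).
  + by congr (_ * (_ / _ - _) ^+ 2); apply: eq_bigr => i _; rewrite posX.
  + by congr (_ * (_ / _ - _) ^+ 2); apply: eq_bigr => i _; rewrite posX.
  + by congr ((_ / _ - _) ^+ 2); apply: eq_bigr => i _; rewrite posX.
  + by rewrite mulrC; congr (_ * _); apply: eq_bigr => i _; rewrite posX.
- rewrite -mulrA; exact: le_ge0_integralZ.
Qed.

End expectation_bound.

Theorem theorem1 (R : realType) (d : measure_display) (T : measurableType d)
    (P : probability T R) (W : {RV P >-> R})
    (X : forall n : nat, 'I_n -> {RV P >-> R}) (k : nat) :
  (3 <= k)%N ->
  P [set t | 0 < W t] = 1%E ->
  (forall n : nat, iid_copies W (X n)) ->
  (fine (P [set t | x < W t]) * x ^+ (2 * k + 1)) @[x --> +oo%R] --> 0%R ->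
  let lam : R := (fine 'E_P[fun t => W t ^+ 2] / fine 'E_P[W]) ^+ k / (2 * k)%:R in
  exists C : R, exists N : nat, forall n : nat, (N <= n)%N ->
    (tv_dist (fun h => 'E_P[fun t => grg_cond_Eh k (fun i => X n i t) h])
             (fun h => (poisson_Eh lam h)%:E)
     <= (C / Num.sqrt n%:R)%:E)%E.
Proof.
case: k => [|[|[|m]]] // k3 W1 iidX tail lam.
have M6 := sixth_moment_lty d T P W m.+3 k3 tail.
have mpos := @pos_measurable R.
have p0 := @pos_ge0 R.
have bound (y : R) j : (j <= 6)%N -> 0 <= (Num.max y 0) ^+ j <= (1 + Num.max y 0) ^+ 6.
  move=> j6; rewrite exprn_ge0 //=; apply: (@le_trans _ _ ((1 + Num.max y 0) ^+ j)).
    by rewrite lerXn2r ?nnegrE ?addr_ge0 // lerDr.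
  by rewrite ler_weXn2l // lerDl.
have mom j : (j <= 6)%N -> exists v : R, (\int[P]_t ((Num.max (W t) 0) ^+ j)%:E = v%:E)%E.
  move=> j6; apply: (moment_fin d T P W M6 (fun y => Num.max y 0 ^+ j)).
    exact: measurable_funX.
  by move=> y; exact: bound.
have [m1 m1E] : exists v : R, (\int[P]_t (Num.max (W t) 0)%:E = v%:E)%E.
  by have [v vE] := mom 1%N isT; exists v; rewrite -vE; under [RHS]eq_integral do rewrite expr1.
have [m2 m2E] := mom 2%N isT.
have [v4 v4E'] := mom 4%N isT.
have v4E : (\int[P]_t ((Num.max (W t) 0 ^+ 2) ^+ 2)%:E = v4%:E)%E.
  by rewrite -v4E'; apply: eq_integral => t _; rewrite -exprM.
have [c6 c6E] := mom 6%N isT.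
have mp1 : measurable_fun [set: R] (fun y : R => 1 + Num.max y 0).
  exact: measurable_funD.
have [c cE] : exists v : R, (\int[P]_t ((1 + Num.max (W t) 0) ^+ 6)%:E = v%:E)%E.
  apply: (moment_fin d T P W M6 (fun y => (1 + Num.max y 0) ^+ 6)).
    exact: measurable_funX.
  by move=> y; rewrite exprn_ge0 ?addr_ge0 /=.
have [m3 m3E] : exists v : R, (\int[P]_t (weight4 (Num.max (W t) 0))%:E = v%:E)%E.
  apply: (moment_fin d T P W M6 (fun y => weight4 (Num.max y 0))).
    by apply: measurable_funM; exact: measurable_funX.
  move=> y; rewrite /weight4 mulr_ge0 ?exprn_ge0 ?addr_ge0 //=.
  apply: (@le_trans _ _ ((1 + Num.max y 0) ^+ 2 * (1 + Num.max y 0) ^+ 2)).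
    by rewrite ler_wpM2r ?exprn_ge0 ?addr_ge0 // lerXn2r ?nnegrE ?addr_ge0 // lerDr.
  by rewrite -exprD ler_weXn2l // lerDl.
have m1_gt0 : 0 < m1.
  by apply: (integral_gt0 d T P W (fun y => Num.max y 0)) m1E => // y y0; rewrite lt_max y0.
have lamE : lam = (m2 / m1) ^+ m.+3 / (2 * m.+3)%:R.
  rewrite /lam unlock; congr ((_ / _) ^+ _ / _).
    by rewrite (integral_pos d T P W (fun y => y ^+ 2)) // m2E.
  by rewrite (integral_pos d T P W id) // m1E.
have m2_gt0 : 0 < m2.
  apply: (integral_gt0 d T P W (fun y => Num.max y 0 ^+ 2)) m2E => //.
  - exact: measurable_funX.
  - by move=> y; rewrite sqr_ge0.
  - by move=> y y0; rewrite exprn_gt0 // lt_max y0.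
have lam_gt0 : 0 < lam.
  by rewrite lamE divr_gt0 ?ltr0n // exprn_gt0 // divr_gt0.
pose B := 2 * expR lam.
(* Independent of both [n] and [h]: [B] bounds the Stein solution for every [h] with values in
   [[-1, 1]], so the supremum over [h] costs nothing. *)
exists (pointwise_const m m1 m2 (m3 + 1) B * (m2 + v4 + 4 * c + c6 + 1)).
(* From this rank on [2 <= m1 * n], so a mean weight of at least [m1 / 2] makes the total weight at
   least 1. *)
exists (Num.bound (2 / m1)).+1 => n nN.
have n_gt0 : (0 < n)%N by apply: leq_trans nN.
have n_large : 2 <= m1 * n%:R.
  rewrite mulrC -ler_pdivrMr //; apply: ltW.
  apply: lt_le_trans (archi_boundP _) _; first by rewrite divr_ge0 // ltW.
  by rewrite ler_nat ltnW.
apply: ge_ereal_sup => _ [h hn <-].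
have h1 j : `|h j| <= 1.
  rewrite -lee_fin -hn; apply: ereal_sup_ubound; by exists j.
have [f [fB fh]] := stein_solution lam h lam_gt0 h1.
rewrite unlock; rewrite lamE in lam_gt0 fh *.
apply: (expectation_bound d T P W n m (X n) (iidX n) W1 m1 m2 m3 v4 c6 c) => //.
exact: poisson_Eh_le1.
Qed.
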